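(* There is a nondeterministic logarithmic-space Turing machine which, given the canonical encoding of a finite ordered graph $(G,<)$ and (indices of) two vertices $v,w$ of $G$, accepts if and only if $v\prec_B w$.
   Context: A finite ordered graph $(G,<)$ is a finite undirected graph with a linear order on its vertices; its canonical encoding is the standard string encoding relative to $<$. The canonical breadth-first order $\prec_B$: for vertices $v,w$ let $v_0,w_0$ be the $<$-least vertices of the connected components of $v$ and $w$ respectively. Let $<^\star$ be the order on finite sequences of vertices comparing first by length and then lexicographically with respect to $<$. Let $\vec v$ denote the $<^\star$-least path from $v_0$ to $v$ (and similarly $\vec w$). Then: if $v_0\ne w_0$, $v\prec_B w$ iff $v_0<w_0$; if $v_0=w_0$, $v\prec_B w$ iff $\vec v<^\star\vec w$. *)

(* Defs.v *)
From Stdlib Require List.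
From mathcomp Require Import all_boot.
Set Implicit Arguments. Unset Strict Implicit. Unset Printing Implicit Defensive.

(* Finite ordered graphs: vertex set 'I_n with its natural order <,   *)
(* edge relation e : rel 'I_n (assumed symmetric and irreflexive).     *)

Section Graph.
Variables (n : nat) (e : rel 'I_n).

Definition comp_min (v : 'I_n) : 'I_n :=
  [arg min_(u < v | connect e v u) (u : nat)].

Fixpoint lexlt (p q : seq 'I_n) : bool :=
  match p, q with
  | [::], [::] => false
  | [::], _ :: _ => true
  | _ :: _, [::] => false
  | a :: p', b :: q' => (a < b) || ((a == b) && lexlt p' q')
  end.

Definition starlt (p q : seq 'I_n) : bool :=
  (size p < size q) || ((size p == size q) && lexlt p q).

Definition is_path_from_to (u v : 'I_n) (p : seq 'I_n) : bool :=
  match p with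
  | [::] => false
  | a :: p' => [&& a == u, path e a p' & last a p' == v]
  end.

Definition least_path (u v : 'I_n) (p : seq 'I_n) : Prop :=
  is_path_from_to u v p /\ forall q, is_path_from_to u v q -> ~~ starlt q p.

Definition precB (v w : 'I_n) : Prop :=
  let v0 := comp_min v in
  let w0 := comp_min w in
  if v0 != w0 then is_true (v0 < w0)%N
  else exists p q, [/\ least_path v0 v p, least_path w0 w q & starlt p q].

End Graph.

Inductive sym := S0 | S1 | SHash.

Definition bitsym (b : bool) : sym := if b then S1 else S0.

Fixpoint bin_aux (fuel m : nat) : seq sym :=
  match fuel with
  | 0 => [::]
  | fuel'.+1 => if m is 0 then [::] else bitsym (odd m) :: bin_aux fuel' m./2
  end.

(* binary representation of m (LSB first; 0 is the empty word) *)
Definition bin (m : nat) : seq sym := bin_aux m m.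

Definition encode (n : nat) (e : rel 'I_n) (v w : 'I_n) : seq sym :=
  [seq bitsym (e i j) | i <- enum 'I_n, j <- enum 'I_n]
    ++ SHash :: bin v ++ SHash :: bin w.

(* Nondeterministic Turing machines with a read-only input tape       *)
(* (with end markers) and one read/write work tape.                   *)

Inductive dir := DL | DS | DR.

Record NTM := {
  state : finType;
  gam : finType;            (* work tape alphabet *)
  blank : gam;
  q_init : state;
  q_acc : state;
  (* delta q (input symbol under head; None = end marker) (work symbol) *)
  delta : state -> option sym -> gam -> seq (state * gam * dir * dir)
}.

Record config (M : NTM) := Config {
  cstate : state M;
  ipos : nat;               (* 0 = left marker, 1..N input, N+1 right marker *)
  wtape : seq (gam M);      (* work tape, blank beyond its end *)
  wpos : nat
}.

Definition read_input (x : seq sym) (i : nat) : option sym :=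
  if (0 < i <= size x)%N then Some (nth S0 x i.-1) else None.

Definition move_in (N : nat) (d : dir) (i : nat) : nat :=
  match d with DL => i.-1 | DS => i | DR => minn i.+1 N.+1 end.

Definition move_w (d : dir) (h : nat) : nat :=
  match d with DL => h.-1 | DS => h | DR => h.+1 end.

Definition step (M : NTM) (x : seq sym) (c c' : config M) : Prop :=
  exists q' g di dw,
    List.In (q', g, di, dw)
      (delta (cstate c) (read_input x (ipos c)) (nth (blank M) (wtape c) (wpos c)))
    /\ c' = Config q' (move_in (size x) di (ipos c))
                      (set_nth (blank M) (wtape c) (wpos c) g)
                      (move_w dw (wpos c)).

Definition init_config (M : NTM) : config M := Config (q_init M) 0 [::] 0.

Inductive reach (M : NTM) (x : seq sym) : config M -> Prop :=
  | reach_init : reach x (init_config M)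
  | reach_step c c' : reach x c -> step x c c' -> reach x c'.

Definition accepts (M : NTM) (x : seq sym) : Prop :=
  exists c, reach x c /\ cstate c = q_acc M.

Definition space (M : NTM) (c : config M) : nat := maxn (size (wtape c)) (wpos c).+1.

Definition logspace (M : NTM) : Prop :=
  exists k, forall x (c : config M), reach x c ->
    (space c <= k * (trunc_log 2 (size x)).+1)%N.

(* Main.v *)
From Stdlib Require Import FunctionalExtensionality.
From Stdlib Require List.
Require Import Defs.
From mathcomp Require Import all_boot zify.
Set Implicit Arguments. Unset Strict Implicit. Unset Printing Implicit Defensive.

(** Nondeterministic logarithmic space is captured by a positive logic over the
    numbers below a bound [B > |x| + 1]: equality, successor, input symbols,
    conjunction, disjunction, existential quantification and reachability along
    a definable relation on tuples.  A formula is evaluated by a nondeterministic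
    register machine whose quantifiers are guesses and whose reachability operator
    is a loop; its registers are the tracks of a work tape of [log B] cells, and
    bounded universal quantification is a loop as well.

    The order [precB] becomes definable once "there is no walk of length [r] from
    [s] to [y]" is, which is the inductive counting argument of Immerman and
    Szelepcsenyi.  The minimum of a component, distances, and the least vertex
    that continues a shortest path towards [v] are then definable, and two least
    paths of equal length are compared by following their common prefix. *)

(** What shapes the proof is that a program has no else branch: a failing test merely blocks the
    run. This suits acceptance, where one successful run is enough, but it leaves no negation, so
    every negative fact needs a certificate that can be guessed and checked. For a non-edge this is
    a 0 in the matrix, for an inequality a strict comparison; the absence of a walk has no such
    local certificate and gets one from counting. Minimality always says that something smaller does
    not exist, so component minima, distances and next vertices all rest on it. A path does not fit
    in logarithmic space, so least paths are never stored: only the current vertex is kept and its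
    successor is determined anew. The space bound covers all reachable configurations, those of
    failing runs included; hence each layer is specified twice, by what completed runs compute and
    by where partial runs can be. The logarithm of the input length is not given either: the machine
    finds a word length by counting input positions. *)

Section Star.
Variables (X : Type) (R : X -> X -> Prop).

Inductive star : X -> X -> Prop :=
  | star_refl x : star x x
  | star_step x y z : R x y -> star y z -> star x z.

Lemma star_trans x y z : star x y -> star y z -> star x z.
Proof. by elim=> // a b c Rab _ IH /IH; apply: star_step. Qed.

Lemma star_one x y : R x y -> star x y.
Proof. by move=> Rxy; apply: star_step Rxy (star_refl y). Qed.

Lemma star_rstep x y z : star x y -> R y z -> star x z.
Proof. by move=> Sxy /star_one; apply: star_trans. Qed.

Lemma star_inv (P : X -> Prop) x y :
  (forall a b, P a -> R a b -> P b) -> P x -> star x y -> P y.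
Proof. by move=> PR Px Sxy; elim: Sxy Px => // a b c Rab _ IH /PR/(_ Rab). Qed.

End Star.

Lemma star_map X Y (R : X -> X -> Prop) (S : Y -> Y -> Prop) (f : X -> Y) x y :
  (forall a b, R a b -> S (f a) (f b)) -> star R x y -> star S (f x) (f y).
Proof.
move=> RS; elim=> [a|a b c Rab _ IH]; first exact: star_refl.
exact: star_step (RS _ _ Rab) IH.
Qed.

(** * Regular programs and their automata *)

Inductive re (A : Type) :=
  Eps | At of A | Seq of re A & re A | Alt of re A & re A | Star of re A.
Arguments Eps {A}.

Section Semantics.
Variables (X A : Type) (R : A -> X -> X -> Prop).

Fixpoint sem (c : re A) : X -> X -> Prop :=
  match c with
  | Eps => eq
  | At a => R a
  | Seq c1 c2 => fun x z => exists2 y, sem c1 x y & sem c2 y z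
  | Alt c1 c2 => fun x y => sem c1 x y \/ sem c2 x y
  | Star c1 => star (sem c1)
  end.

(* [pre c x y]: some partial run of [c] from [x] passes through [y].  Space
   bounds concern these intermediate configurations. *)
Fixpoint pre (c : re A) : X -> X -> Prop :=
  match c with
  | Eps => eq
  | At a => fun x y => x = y \/ R a x y
  | Seq c1 c2 => fun x z => pre c1 x z \/ exists2 y, sem c1 x y & pre c2 y z
  | Alt c1 c2 => fun x y => pre c1 x y \/ pre c2 x y
  | Star c1 => fun x z => exists2 y, star (sem c1) x y & pre c1 y z
  end.

Lemma pre_refl c x : pre c x x.
Proof.
elim: c x => //= [a|c1 IH1 c2 _|c1 IH1 c2 _|c IH] x; try by left.
by exists x => //; apply: star_refl.
Qed.

Lemma sem_pre c x y : sem c x y -> pre c x y.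
Proof.
elim: c x y => //= [a|c1 IH1 c2 IH2|c1 IH1 c2 IH2|c IH] x y.
- by right.
- by case=> z xz zy; right; exists z => //; apply: IH2.
- by case=> [/IH1|/IH2]; [left|right].
- by move=> xy; exists y => //; apply: pre_refl.
Qed.

Fixpoint allat (P : A -> Prop) (c : re A) : Prop :=
  match c with
  | Eps => True
  | At a => P a
  | Seq c1 c2 | Alt c1 c2 => allat P c1 /\ allat P c2
  | Star c1 => allat P c1
  end.

Lemma pre_inv (I : X -> Prop) (P : A -> Prop) c :
  (forall a x y, P a -> I x -> R a x y -> I y) -> allat P c ->
  forall x y, I x -> pre c x y -> I y.
Proof.
move=> IR; elim: c => /= [|a|c1 IH1 c2 IH2|c1 IH1 c2 IH2|c IH].
- by move=> _ x y Ix <-.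
- by move=> Pa x y Ix [<-|/(IR _ _ _ Pa Ix)].
- move=> [P1 P2] x y Ix [/(IH1 P1 _ _ Ix)|[z /sem_pre/(IH1 P1 _ _ Ix) Iz]] //.
  exact: IH2.
- by move=> [P1 P2] x y Ix [/(IH1 P1 _ _ Ix)|/(IH2 P2 _ _ Ix)].
- move=> /IH {}IH x y Ix [z xz]; apply: (IH).
  by apply: star_inv xz => // a b Ia /sem_pre; apply: (IH).
Qed.

Lemma sem_inv (I : X -> Prop) (P : A -> Prop) c :
  (forall a x y, P a -> I x -> R a x y -> I y) -> allat P c ->
  forall x y, I x -> sem c x y -> I y.
Proof. by move=> IR Pc x y Ix /sem_pre; apply: (pre_inv IR Pc). Qed.

End Semantics.

Record aut (A : Type) := Aut {
  ast : finType; asrc : ast; adst : ast;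
  aedge : ast -> seq (option A * ast)
}.

Section Thompson.
Variable A : Type.

Definition retarget (S T : Type) (f : S -> T) (l : seq (option A * S)) :=
  [seq (e.1, f e.2) | e <- l].

Definition aut_eps : aut A :=
  @Aut A bool false true (fun s => if s then [::] else [:: (None, true)]).

Definition aut_at (a : A) : aut A :=
  @Aut A bool false true (fun s => if s then [::] else [:: (Some a, true)]).

Definition aut_seq (M N : aut A) : aut A :=
  @Aut A (ast M + ast N)%type (inl (asrc M)) (inr (adst N)) (fun s =>
    match s with
    | inl s => (if s == adst M then [:: (None, inr (asrc N))] else [::])
                 ++ retarget inl (aedge s)
    | inr s => retarget inr (aedge s)
    end).

Definition aut_alt (M N : aut A) : aut A :=
  @Aut A (bool + (ast M + ast N))%type (inl false) (inl true) (fun s =>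
    match s with
    | inl false => [:: (None, inr (inl (asrc M))); (None, inr (inr (asrc N)))]
    | inl true => [::]
    | inr (inl s) => (if s == adst M then [:: (None, inl true)] else [::])
                 ++ retarget (fun s => inr (inl s)) (aedge s)
    | inr (inr s) => (if s == adst N then [:: (None, inl true)] else [::])
                 ++ retarget (fun s => inr (inr s)) (aedge s)
    end).

(** The fresh state [None] is both entry and exit, so zero iterations need no edge of their own. *)
Definition aut_star (M : aut A) : aut A :=
  @Aut A (option (ast M)) None None (fun s =>
    match s with
    | None => [:: (None, Some (asrc M))]
    | Some s => (if s == adst M then [:: (None, None)] else [::])
                 ++ retarget Some (aedge s)
    end).

Fixpoint thompson (c : re A) : aut A :=
  match c with
  | Eps => aut_eps
  | At a => aut_at a
  | Seq c1 c2 => aut_seq (thompson c1) (thompson c2)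
  | Alt c1 c2 => aut_alt (thompson c1) (thompson c2)
  | Star c1 => aut_star (thompson c1)
  end.

Variables (X : Type) (R : A -> X -> X -> Prop).

Definition osem (oa : option A) : X -> X -> Prop :=
  if oa is Some a then R a else eq.

Definition astep (M : aut A) (p q : ast M * X) : Prop :=
  exists2 oa, List.In (oa, q.1) (aedge p.1) & osem oa p.2 q.2.

Lemma In_retarget (S T : eqType) (f : S -> T) l oa t :
  List.In (oa, t) (retarget f l) -> exists2 s, t = f s & List.In (oa, s) l.
Proof.
move=> /List.in_map_iff [[oa' s] [/= [<- <-] H]]; by exists s.
Qed.

Lemma retarget_In (S T : Type) (f : S -> T) l oa s :
  List.In (oa, s) l -> List.In (oa, f s) (retarget f l).
Proof. by move=> H; apply/List.in_map_iff; exists (oa, s). Qed.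

Lemma In_exit (S T : eqType) (f : S -> T) (s d : S) (e : T) l oa t :
  List.In (oa, t) ((if s == d then [:: (None, e)] else [::]) ++ retarget f l) ->
  [/\ oa = None, s = d & t = e] \/ exists2 s', t = f s' & List.In (oa, s') l.
Proof.
rewrite List.in_app_iff => -[|H]; last by right; apply: In_retarget H.
case: (s =P d) => [->|_] /= H; last by [].
by case: H => [[<- <-]|[]]; left.
Qed.

(** The invariant attached to each state records which subprogram is under way and what was
    completed before it. Arbitrary reachable states are covered, because the space bound needs
    them. *)
Lemma thompson_sound (c : re A) x s y :
  star (@astep (thompson c)) (asrc (thompson c), x) (s, y) ->
  pre R c x y /\ (s = adst (thompson c) -> sem R c x y).
Proof.
elim: c x s y => /= [|a|c1 IH1 c2 IH2|c1 IH1 c2 IH2|c IH] x s y H.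
- pose P (q : bool * X) := x = q.2.
  suff: P (s, y) by [].
  apply: star_inv H => // -[u a] [v b]; rewrite /P /= => -> [oa] /=.
  by case: u => //= -[] // [<- _] /=.
- pose P (q : bool * X) := if q.1 then R a x q.2 else x = q.2.
  suff: P (s, y) by case: s {H} => /=; [split; [right|] | split; [left|]].
  apply: star_inv H => // -[u b] [v d]; rewrite /P /= => H [oa] /=.
  by case: u H => //= <- [] // [<- <-] /=.
- set M := thompson c1 in IH1 H *; set N := thompson c2 in IH2 H *.
  pose P (q : ast (aut_seq M N) * X) := match q.1 with
    | inl u => star (@astep M) (asrc M, x) (u, q.2)
    | inr u => exists2 z, sem R c1 x z & star (@astep N) (asrc N, z) (u, q.2) end.
  have : P (s, y).
    apply: star_inv H; last exact: star_refl.
    move=> [[u|u] a] [v b]; rewrite /P /=.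
      move=> Hu [oa] /= /In_exit [[-> eu ->] /= <-|[u' -> Hin] Hab].
        exists a; last exact: star_refl.
        by have [_] := IH1 _ _ _ Hu; apply.
      by apply: star_rstep Hu _; exists oa.
    move=> [z Hz Hu] [oa] /= /In_retarget [u' -> Hin] Hab.
    by exists z => //; apply: star_rstep Hu _; exists oa.
  case: s {H} => s; rewrite /P /=.
    by move=> /IH1 [H _]; split=> //; left.
  move=> [z Hz /IH2 [H1 H2]]; split; first by right; exists z.
  by case=> /H2 H; exists z.
- set M := thompson c1 in IH1 H *; set N := thompson c2 in IH2 H *.
  pose P (q : ast (aut_alt M N) * X) := match q.1 with
    | inl false => x = q.2
    | inl true => sem R c1 x q.2 \/ sem R c2 x q.2
    | inr (inl u) => star (@astep M) (asrc M, x) (u, q.2)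
    | inr (inr u) => star (@astep N) (asrc N, x) (u, q.2) end.
  have : P (s, y).
    apply: star_inv H; last by [].
    move=> [[[]|[u|u]] a] [v b]; rewrite /P /=.
    + by move=> _ [oa].
    + by move=> -> [oa] /= [[<- <-]|[[<- <-]|[]]] /= ->; apply: star_refl.
    + move=> Hu [oa] /= /In_exit [[-> eu ->] /= <-|[u' -> Hin] Hab].
        by left; have [_] := IH1 _ _ _ Hu; apply.
      by apply: star_rstep Hu _; exists oa.
    + move=> Hu [oa] /= /In_exit [[-> eu ->] /= <-|[u' -> Hin] Hab].
        by right; have [_] := IH2 _ _ _ Hu; apply.
      by apply: star_rstep Hu _; exists oa.
  case: s {H} => [[]|[s|s]]; rewrite /P /=.
  + by move=> H; split=> //; case: H => H; [left|right]; apply: sem_pre.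
  + by move=> <-; split=> //; left; apply: pre_refl.
  + by move=> /IH1 [H _]; split=> //; left.
  + by move=> /IH2 [H _]; split=> //; right.
- set M := thompson c in IH H *.
  pose P (q : ast (aut_star M) * X) := match q.1 with
    | None => star (sem R c) x q.2
    | Some u => exists2 z, star (sem R c) x z & star (@astep M) (asrc M, z) (u, q.2)
    end.
  have : P (s, y).
    apply: star_inv H; last exact: star_refl.
    move=> [[u|] a] [v b]; rewrite /P /=.
      move=> [z Hz Hu] [oa] /= /In_exit [[-> eu ->] /= <-|[u' -> Hin] Hab].
        by apply: star_rstep Hz _; have [_] := IH _ _ _ Hu; apply.
      by exists z => //; apply: star_rstep Hu _; exists oa.
    move=> Ha [oa] /= [[<- <-]|[]] /= <-; exists a => //; exact: star_refl.
  case: s {H} => [s|]; rewrite /P /=.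
    by move=> [z Hz /IH [H _]]; split=> //; exists z.
  by move=> H; split=> //; exists y => //; apply: pre_refl.
Qed.

Lemma thompson_complete (c : re A) x y : sem R c x y ->
  star (@astep (thompson c)) (asrc (thompson c), x) (adst (thompson c), y).
Proof.
elim: c x y => /= [|a|c1 IH1 c2 IH2|c1 IH1 c2 IH2|c IH] x y.
- by move=> <-; apply: star_one; exists None => //=; left.
- by move=> H; apply: star_one; exists (Some a) => //=; left.
- move=> [z /IH1 H1 /IH2 H2].
  set M := thompson c1 in H1 *; set N := thompson c2 in H2 *.
  apply: (@star_trans _ _ _ (inl (adst M), z)).
    apply: (@star_map _ _ _ _ (fun q => (inl q.1 : ast (aut_seq M N), q.2))) H1.
    move=> [u a] [v b] [oa /= Hin Hab]; exists oa => //=.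
    by apply/List.in_app_iff; right; apply: retarget_In.
  apply: (@star_step _ _ _ (inr (asrc N), z)).
    by exists None => //=; rewrite eqxx; left.
  apply: (@star_map _ _ _ _ (fun q => (inr q.1 : ast (aut_seq M N), q.2))) H2.
  move=> [u a] [v b] [oa /= Hin Hab]; exists oa => //=.
  exact: retarget_In.
- set M := thompson c1 in IH1 *; set N := thompson c2 in IH2 *.
  case=> [/IH1|/IH2] H.
    apply: (@star_step _ _ _ (inr (inl (asrc M)), x)).
      by exists None => //=; left.
    apply: (@star_rstep _ _ _ (inr (inl (adst M)), y)); last first.
      by exists None => //=; rewrite eqxx; left.
    apply: (@star_map _ _ _ _ (fun q => (inr (inl q.1) : ast (aut_alt M N), q.2))) H.
    move=> [u a] [v b] [oa /= Hin Hab]; exists oa => //=.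
    by apply/List.in_app_iff; right; apply: (retarget_In (fun s => inr (inl s))).
  apply: (@star_step _ _ _ (inr (inr (asrc N)), x)).
    by exists None => //=; right; left.
  apply: (@star_rstep _ _ _ (inr (inr (adst N)), y)); last first.
    by exists None => //=; rewrite eqxx; left.
  apply: (@star_map _ _ _ _ (fun q => (inr (inr q.1) : ast (aut_alt M N), q.2))) H.
  move=> [u a] [v b] [oa /= Hin Hab]; exists oa => //=.
  by apply/List.in_app_iff; right; apply: (retarget_In (fun s => inr (inr s))).
- set M := thompson c in IH *.
  elim=> [z|a b d /IH Hab _ Hbd]; first exact: star_refl.
  apply: (@star_step _ _ _ (Some (asrc M), a)); first by exists None => //=; left.
  apply: star_trans Hbd.
  apply: (@star_rstep _ _ _ (Some (adst M), b)); last first.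
    by exists None => //=; rewrite eqxx; left.
  apply: (@star_map _ _ _ _ (fun q => (Some q.1 : ast (aut_star M), q.2))) Hab.
  move=> [u p] [v q] [oa /= Hin Hpq]; exists oa => //=.
  by apply/List.in_app_iff; right; apply: retarget_In.
Qed.

End Thompson.

(** * Turing machines from regular programs over tape actions *)

Definition upd (T : Type) (f : nat -> T) (p : nat) (g : T) : nat -> T :=
  fun i => if i == p then g else f i.

Lemma upd_same T (f : nat -> T) p : upd f p (f p) = f.
Proof. by apply: functional_extensionality => i; rewrite /upd; case: eqP => // ->. Qed.

Section Machine.
Variables (G : finType) (b0 : G).

Definition act := option sym -> G -> option (G * dir * dir).

(* Configurations without control state; the work tape is a total function, so
   that rewriting a cell with its own content is the identity. *)
Record cfg := Cfg { cin : nat; ctape : nat -> G; cpos : nat }.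

Definition act_sem (x : seq sym) (a : act) (c c' : cfg) : Prop :=
  exists g di dw, a (read_input x (cin c)) (ctape c (cpos c)) = Some (g, di, dw) /\
    c' = Cfg (move_in (size x) di (cin c)) (upd (ctape c) (cpos c) g)
             (move_w dw (cpos c)).

Definition init_cfg : cfg := Cfg 0 (fun=> b0) 0.

Definition oact (oa : option act) : act :=
  if oa is Some a then a else fun _ g => Some (g, DS, DS).

(** An action that does not apply contributes no transition; this is how a failing test blocks a
    run. Silent edges rewrite the scanned symbol and stay in place. *)
Definition machine (c : re act) : NTM :=
  {| state := ast (thompson c); gam := G; blank := b0;
     q_init := asrc (thompson c); q_acc := adst (thompson c);
     delta q s g := pmap (fun e : option act * ast (thompson c) =>
       if oact e.1 s g is Some (g', di, dw) then Some (e.2, g', di, dw) else None)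
       (aedge q) |}.

Variables (c : re act) (x : seq sym).
Let M := machine c.

Definition abs (k : config M) : cfg := Cfg (ipos k) (nth b0 (wtape k)) (wpos k).

Lemma In_pmap (S T : Type) (f : S -> option T) (l : seq S) t :
  List.In t (pmap f l) <-> exists2 s, List.In s l & f s = Some t.
Proof.
elim: l => [|s l IH] /=; first by split=> // -[].
case E: (f s) => [t'|] /=; split.
- by case=> [<-|/IH [s' ? ?]]; [exists s; [left|]|exists s'; [right|]].
- by case=> s' [<-|H] Es'; [left; move: Es'; rewrite E => -[]|right; apply/IH; exists s'].
- by move=> /IH [s' ? ?]; exists s'; [right|].
- by case=> s' [<-|H] Es'; [rewrite E in Es'|apply/IH; exists s'].
Qed.

Lemma oact_sem oa (k k' : cfg) : osem (act_sem x) oa k k' <-> act_sem x (oact oa) k k'.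
Proof.
case: oa => [a|] //=; split.
  by move=> <-; exists (ctape k (cpos k)), DS, DS; split=> //; rewrite upd_same; case: k.
by case=> g [di [dw [[<- <- <-] ->]]] /=; rewrite upd_same; case: k.
Qed.

Lemma step_astep (k k' : config M) : step x k k' ->
  astep (act_sem x) (cstate k, abs k) (cstate k', abs k').
Proof.
case=> q' [g [di [dw [/In_pmap [[oa q] Hin /=]]]]].
case E: (oact _ _ _) => [[[g' di'] dw']|] // [eq1 eq2 eq3 eq4] ->; subst.
exists oa => //=; apply/oact_sem; exists g, di, dw; split=> //.
rewrite /abs /=; congr Cfg; apply: functional_extensionality => i.
by rewrite nth_set_nth.
Qed.

Lemma astep_step (k : config M) q' k1 :
  astep (act_sem x) (cstate k, abs k) (q', k1) ->
  exists k', [/\ step x k k', cstate k' = q' & abs k' = k1].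
Proof.
case=> oa /= Hin /oact_sem [g [di [dw [E ->]]]].
pose k' := @Config M q' (move_in (size x) di (ipos k))
               (set_nth b0 (wtape k) (wpos k) g) (move_w dw (wpos k)).
exists k'; split=> //.
  exists q', g, di, dw; split=> //; apply/In_pmap; exists (oa, q') => //=.
  by move: E => /= ->.
rewrite /abs /=; congr Cfg; apply: functional_extensionality => i.
by rewrite nth_set_nth.
Qed.

Lemma reach_star (k : config M) : reach x k ->
  star (@astep _ _ (act_sem x) (thompson c)) (asrc (thompson c), init_cfg) (cstate k, abs k).
Proof.
elim=> [|k1 k2 _ IH /step_astep H]; last exact: star_rstep IH H.
have -> : abs (init_config M) = init_cfg.
  by rewrite /abs /init_cfg /=; congr Cfg; apply: functional_extensionality => -[].
exact: star_refl.
Qed.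

Lemma star_reach q k1 :
  star (@astep _ _ (act_sem x) (thompson c)) (asrc (thompson c), init_cfg) (q, k1) ->
  exists k : config M, [/\ reach x k, cstate k = q & abs k = k1].
Proof.
pose P (p : ast (thompson c) * cfg) :=
  exists k : config M, [/\ reach x k, cstate k = p.1 & abs k = p.2].
move=> H; suff: P (q, k1) by [].
apply: star_inv H.
  move=> [q1 a] [q2 b] [k /= [Rk <- <-]] /astep_step [k' [Hs E1 E2]].
  by exists k'; split=> //; apply: reach_step Rk Hs.
exists (init_config M); split=> //; first exact: reach_init.
by rewrite /abs /init_cfg /=; congr Cfg; apply: functional_extensionality => -[].
Qed.

Lemma machine_accepts : accepts M x <-> exists k, sem (act_sem x) c init_cfg k.
Proof.
split.
  case=> k [/reach_star Rk Ek]; exists (abs k).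
  by have [_] := thompson_sound Rk; apply.
case=> k1 H; have [k [Rk Ek _]] := star_reach (thompson_complete H).
by exists k.
Qed.

(** The written part of the tape never reaches beyond a cell visited by the head, so bounding the
    head position is enough. *)
Lemma machine_space b : (forall k, pre (act_sem x) c init_cfg k -> cpos k <= b) ->
  forall k : config M, reach x k -> space k <= b.+1.
Proof.
move=> Hb k Rk; rewrite /space geq_max.
have pos (k' : config M) : reach x k' -> wpos k' <= b.
  by move=> H; have [/Hb] := thompson_sound (reach_star H).
rewrite ltnS pos // andbT.
elim: Rk => // k1 k2 R1 IH [q [g [di [dw [_ ->]]]]] /=.
by rewrite size_set_nth geq_max IH ltnS pos.
Qed.

End Machine.

(** * Implementing the atoms of a program by programs of a lower level *)

Fixpoint bind (A B : Type) (f : A -> re B) (c : re A) : re B :=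
  match c with
  | Eps => Eps
  | At a => f a
  | Seq c1 c2 => Seq (bind f c1) (bind f c2)
  | Alt c1 c2 => Alt (bind f c1) (bind f c2)
  | Star c1 => Star (bind f c1)
  end.

Section Bind.
Variables (A B X Y : Type) (R : A -> X -> X -> Prop) (Q : B -> Y -> Y -> Prop).
Variables (f : A -> re B) (rep : X -> Y) (P : A -> Prop) (I : X -> Prop).
Hypothesis IR : forall a s s', P a -> I s -> R a s s' -> I s'.
Hypothesis simf : forall a s k, P a -> I s ->
  (sem Q (f a) (rep s) k <-> exists2 s', k = rep s' & R a s s').

Lemma bind_sem c s k : allat P c -> I s ->
  (sem Q (bind f c) (rep s) k <-> exists2 s', k = rep s' & sem R c s s').
Proof.
elim: c s k => /= [|a|c1 IH1 c2 IH2|c1 IH1 c2 IH2|c IH] s k.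
- by move=> _ _; split=> [<-|[s' -> <-]] //; exists s.
- exact: simf.
- move=> [P1 P2] Is; split.
    move=> [k1 /(IH1 _ _ P1 Is) [s1 -> H1]].
    have I1 := sem_inv IR P1 Is H1.
    by move=> /(IH2 _ _ P2 I1) [s2 -> H2]; exists s2 => //; exists s1.
  move=> [s2 -> [s1 H1 H2]]; exists (rep s1); first by apply/IH1 => //; exists s1.
  by apply/IH2 => //; [apply: sem_inv IR P1 _ _ Is H1|exists s2].
- move=> [P1 P2] Is; split.
    by case=> [/(IH1 _ _ P1 Is)|/(IH2 _ _ P2 Is)] [s1 -> H]; exists s1; auto.
  by case=> s1 -> [H|H]; [left; apply/IH1|right; apply/IH2] => //; exists s1.
- move=> Pc Is; split=> [|[s' -> H]].
    move E: (rep s) => k0 H; elim: H s Is E => [k1|k0' k1 k2 H01 _ IH12] s Is E.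
      by exists s => //; apply: star_refl.
    move: H01; rewrite -E => /(IH _ _ Pc Is) [s1 E1 H1].
    have I1 := sem_inv IR Pc Is H1.
    by have [s2 -> H2] := IH12 s1 I1 (esym E1); exists s2 => //; apply: star_step H1 H2.
  elim: H Is => [s1|s1 s2 s3 H12 _ IH23] I1; first exact: star_refl.
  apply: star_step (IH23 _); last exact: sem_inv IR Pc _ _ I1 H12.
  by apply/IH => //; exists s2.
Qed.

Variable Good : X -> Y -> Prop.
Hypothesis good_rep : forall s, I s -> Good s (rep s).
Hypothesis good_pre : forall a s k, P a -> I s -> pre Q (f a) (rep s) k -> Good s k.

(** A partial run of the implementation consists of completed atoms, which end in a represented
    state, and at most one unfinished atom; [Good] describes where the latter may be. *)
Lemma bind_pre c s k : allat P c -> I s ->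
  pre Q (bind f c) (rep s) k -> exists2 s1, pre R c s s1 & Good s1 k.
Proof.
elim: c s k => /= [|a|c1 IH1 c2 IH2|c1 IH1 c2 IH2|c IH] s k.
- by move=> _ Is <-; exists s => //; apply: good_rep.
- by move=> Pa Is H; exists s; [left|apply: good_pre H].
- move=> [P1 P2] Is [/(IH1 _ _ P1 Is) [s1 H1 G1]|[k1]].
    by exists s1 => //; left.
  move=> /(bind_sem _ P1 Is) [s1 -> H1].
  have I1 := sem_inv IR P1 Is H1.
  move=> /(IH2 _ _ P2 I1) [s2 H2 G2]; exists s2 => //; right; by exists s1.
- by move=> [P1 P2] Is [/(IH1 _ _ P1 Is)|/(IH2 _ _ P2 Is)] [s1 H1 G1]; exists s1; auto.
- move=> Pc Is [k1].
  move=> /(@bind_sem (Star c) s k1 Pc Is) [s1 -> H1].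
  have I1 := @sem_inv _ _ _ _ _ (Star c) IR Pc _ _ Is H1.
  by move=> /(IH _ _ Pc I1) [s2 H2 G2]; exists s2 => //; exists s1.
Qed.

End Bind.

(** * Binary digits *)

Definition bit (m i : nat) : bool := odd (m %/ 2 ^ i).

Lemma bit0 m : bit m 0 = odd m.
Proof. by rewrite /bit divn1. Qed.

Lemma bitS m i : bit m i.+1 = bit m./2 i.
Proof. by rewrite /bit expnS divnMA divn2. Qed.

Lemma half_expS m L : m < 2 ^ L.+1 -> m./2 < 2 ^ L.
Proof. by rewrite expnS; lia. Qed.

Lemma bit_inj L a b : a < 2 ^ L -> b < 2 ^ L ->
  (forall i, i < L -> bit a i = bit b i) -> a = b.
Proof.
elim: L a b => [|L IH] a b; first by rewrite expn0; case: a; case: b.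
move=> /half_expS Ha /half_expS Hb H.
rewrite -(odd_double_half a) -(odd_double_half b) -!bit0 H //.
by rewrite (IH a./2 b./2) // => i iL; rewrite -!bitS; apply: H.
Qed.

Lemma bit_ex L (f : nat -> bool) :
  exists2 k, k < 2 ^ L & forall i, i < L -> bit k i = f i.
Proof.
elim: L f => [|L IH] f; first by exists 0.
have [k kL Hk] := IH (fun i => f i.+1); exists (f 0 + k.*2).
  by rewrite expnS; case: (f 0); lia.
case=> [_|i iL]; first by rewrite bit0; case: (f 0); lia.
by rewrite bitS -Hk //; congr bit; case: (f 0); lia.
Qed.

(** Carry propagation, with [j] the lowest zero digit of [a]. The three ranges of digits are shaped
    as one scan over two tracks, least significant digit first; an overflow has no such [j]. *)
Lemma bit_suc L a b : a < 2 ^ L -> b < 2 ^ L ->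
  b = a.+1 <-> exists j, [/\ j < L, forall i, i < j -> bit a i && ~~ bit b i,
    ~~ bit a j && bit b j & forall i, j < i < L -> bit a i = bit b i].
Proof.
elim: L a b => [|L IH] a b.
  by rewrite expn0 => a0 b0; split=> [|[j []]] //; lia.
move=> aL bL; have aL2 := half_expS aL; have bL2 := half_expS bL.
have {IH} := IH _ _ aL2 bL2.
have [oa|ea] := boolP (odd a) => IH; last first.
  split=> [ab|[j [jL H1 /andP[H2 H3] H4]]].
    exists 0; split=> //; first by rewrite !bit0; lia.
    by case=> // i _; rewrite !bitS; congr bit; lia.
  have j0 : j = 0 by case: j jL H1 H2 H3 H4 => // j _ /(_ 0 isT); rewrite !bit0 (negbTE ea).
  rewrite {}j0 !bit0 in H1 H2 H3 H4.
  suff: a./2 = b./2 by lia.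
  by apply: bit_inj aL2 bL2 _ => i iL; rewrite -!bitS; apply: H4.
have -> : (b = a.+1) <-> ~~ odd b /\ b./2 = a./2.+1 by lia.
rewrite IH; split.
  move=> [eb [j [jL H1 H2 H3]]]; exists j.+1; split=> //; rewrite ?bitS //.
    by case=> [_|i]; rewrite ?bit0 ?bitS ?oa //; apply: H1.
  by case=> // i; rewrite !bitS; apply: H3.
case=> -[|j] [jL H1 H2 H3]; first by rewrite bit0 oa in H2.
split; first by move: (H1 0 isT); rewrite !bit0 oa.
exists j; split=> //; rewrite -?bitS //.
  by move=> i ij; rewrite -!bitS; apply: H1.
by move=> i ij; rewrite -!bitS; apply: H3.
Qed.

Lemma bit_ones L a : a < 2 ^ L -> (forall i, i < L -> bit a i) <-> a.+1 = 2 ^ L.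
Proof.
elim: L a => [|L IH] a aL; first by rewrite expn0 in aL *; split=> //; lia.
have aL2 := half_expS aL.
have -> : (a.+1 = 2 ^ L.+1) <-> odd a /\ a./2.+1 = 2 ^ L by rewrite expnS; lia.
rewrite -IH //; split.
  by move=> H; split=> [|i iL]; rewrite -?bit0 -?bitS H.
by case=> oa H [|i] iL; rewrite ?bit0 ?bitS //; apply: H.
Qed.

Lemma bit_big L m i : m < 2 ^ L -> L <= i -> bit m i = false.
Proof.
by move=> mL Li; rewrite /bit divn_small // (leq_trans mL) // leq_pexp2l.
Qed.

(** * Register machines on a multi-track work tape *)

(* Registers hold [mL]-bit words and [mh] is the input head. *)
Record mstate := MState { mL : nat; mh : nat; mr : nat -> nat }.

(** There is no assignment: a guess followed by a test replaces it. [MGrow] requires register 0 to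
    be all ones, which ties the word length to the value of a counter. *)
Inductive matom :=
  | MGuess of nat
  | MEq of nat & nat
  | MSuc of nat & nat
  | MZero of nat
  | MHome
  | MRight
  | MRead of (option sym -> bool)
  | MGrow.

Definition mstep (x : seq sym) (a : matom) (s s' : mstate) : Prop :=
  match a with
  | MGuess v => exists2 k, k < 2 ^ mL s & s' = MState (mL s) (mh s) (upd (mr s) v k)
  | MEq u v => s' = s /\ mr s u = mr s v
  | MSuc u v => s' = s /\ mr s v = (mr s u).+1
  | MZero v => s' = s /\ mr s v = 0
  | MHome => s' = MState (mL s) 0 (mr s)
  | MRight => s' = MState (mL s) (minn (mh s).+1 (size x).+1) (mr s)
  | MRead P => s' = s /\ P (read_input x (mh s))
  | MGrow => s' = MState (mL s).+1 (mh s) (mr s) /\ (mr s 0).+1 = 2 ^ mL s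
  end.

Definition mwf (x : seq sym) (s : mstate) : Prop :=
  [/\ 0 < mL s, mh s <= (size x).+1 & forall v, mr s v < 2 ^ mL s].

Definition mregs (K : nat) (a : matom) : Prop :=
  match a with
  | MGuess v | MZero v => v <= K
  | MEq u v | MSuc u v => u <= K /\ v <= K
  | _ => True
  end.

Lemma mwf_step x a s s' : mwf x s -> mstep x a s s' -> mwf x s'.
Proof.
case: s => L h r [/= L0 hN rL]; case: a => [v|u v|u v|v|||P|] /=.
- move=> [k kL ->]; split=> //= i; rewrite /upd; by case: eqP.
- by move=> [-> _].
- by move=> [-> _].
- by move=> [-> _].
- by move=> ->.
- by move=> ->; split=> //=; rewrite geq_minr.
- by move=> [-> _].
- move=> [-> _]; split=> //= v; apply: leq_trans (rL v) _.
  by rewrite leq_pexp2l.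
Qed.

Section Tape.
Variable K : nat.

Definition bits : finType := {ffun 'I_K.+1 -> bool}.
Definition cell : finType := option (bool * bits)%type.
Notation cfg := (cfg cell).
Notation act := (act cell).

(* The flag of a cell marks the left end of the tape; [None] is the blank, found
   to the right of the [L] allocated cells. *)
Definition tape (L : nat) (b : nat -> bits) : nat -> cell :=
  fun i => if i < L then Some (i == 0, b i) else None.

Definition rbits (r : nat -> nat) (i : nat) : bits := [ffun u : 'I_K.+1 => bit (r u) i].

Definition rep (s : mstate) : cfg := Cfg (mh s) (tape (mL s) (rbits (mr s))) 0.

Definition on_cell (P : bits -> bool) (f : bits -> bits) : act := fun _ g =>
  if g is Some (m, b) then if P b then Some (Some (m, f b), DS, DR) else None else None.
Definition at_end : act := fun _ g => if g is None then Some (None, DS, DL) else None.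
Definition back : act := fun _ g =>
  if g is Some (false, b) then Some (g, DS, DL) else None.
Definition at_mark : act := fun _ g =>
  if g is Some (true, b) then Some (g, DS, DS) else None.
Definition extend : act := fun _ g =>
  if g is None then Some (Some (false, [ffun=> false]), DS, DS) else None.
Definition start : act := fun _ g => Some (Some (true, [ffun=> false]), DS, DS).
Definition on_input (P : option sym -> bool) (d : dir) : act := fun s g =>
  if P s then Some (g, d, DS) else None.

Definition rewind : re act := Seq (Star (At back)) (At at_mark).
(** Demanding the blank after [c] forces a nondeterministic loop to treat every allocated cell; a
    run leaving it too early is blocked. *)
Definition sweep (c : re act) : re act := Seq c (Seq (At at_end) rewind).

Definition setb (v : 'I_K.+1) (c : bool) (b : bits) : bits :=
  [ffun u => if u == v then c else b u].

Definition test (P : bits -> bool) : re act := At (on_cell P id).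

(** In [MHome] the first move is unconditional because both end markers read as [None]: after one
    step left the head cannot be on the right marker, so the next [None] identifies position 0. *)
Definition ctr (a : matom) : re act :=
  match a with
  | MGuess v => sweep (Star (Alt (At (on_cell predT (setb (inord v) true)))
                                 (At (on_cell predT (setb (inord v) false)))))
  | MEq u v => sweep (Star (test (fun b => b (inord u) == b (inord v))))
  | MSuc u v => sweep (Seq (Star (test (fun b => b (inord u) && ~~ b (inord v))))
                      (Seq (test (fun b => ~~ b (inord u) && b (inord v)))
                           (Star (test (fun b => b (inord u) == b (inord v))))))
  | MZero v => sweep (Star (test (fun b => ~~ b (inord v))))
  | MHome => Seq (At (on_input predT DL)) (Seq (Star (At (on_input isSome DL)))
                 (At (on_input (negb \o isSome) DS)))
  | MRight => At (on_input predT DR)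
  | MRead P => At (on_input P DS)
  | MGrow => Seq (Star (test (fun b => b ord0))) (Seq (At extend) rewind)
  end.

Variable x : seq sym.
Notation asem := (act_sem x).
Notation cf h L b p := (Cfg h (tape L b) p).

Lemma upd_tape L b p c : p < L ->
  upd (tape L b) p (Some (p == 0, c)) = tape L (upd b p c).
Proof.
move=> pL; apply: functional_extensionality => i; rewrite /upd /tape.
by case: (i =P p) => // ->; rewrite pL.
Qed.

Lemma on_cell_sem P f h L b p k :
  asem (on_cell P f) (cf h L b p) k <->
  [/\ p < L, P (b p) & k = cf h L (upd b p (f (b p))) p.+1].
Proof.
rewrite /act_sem /= /on_cell /tape; split.
  move=> [g [di [dw []]]]; case: ltnP => // pL.
  by case: ifP => // Pb [<- <- <-] ->; split=> //; rewrite upd_tape.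
case=> pL Pb ->; rewrite pL Pb.
by exists (Some (p == 0, f (b p))), DS, DR; split=> //=; rewrite upd_tape.
Qed.

Lemma test_sem P h L b p k :
  sem asem (test P) (cf h L b p) k <-> [/\ p < L, P (b p) & k = cf h L b p.+1].
Proof. by rewrite /= on_cell_sem upd_same. Qed.

Lemma at_end_sem h L b p k :
  asem at_end (cf h L b p) k <-> L <= p /\ k = cf h L b p.-1.
Proof.
rewrite /act_sem /= /at_end {1}/tape; split.
  move=> [g [di [dw []]]]; case: ltnP => // Lp [<- <- <-] ->; split=> //=.
  by congr Cfg; rewrite -[RHS](upd_same _ p) /tape ltnNge Lp.
case=> Lp ->; rewrite ltnNge Lp /=; exists None, DS, DL; split=> //=.
by congr Cfg; rewrite -[LHS](upd_same _ p) /tape ltnNge Lp.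
Qed.

Lemma back_sem h L b p k :
  asem back (cf h L b p) k <-> 0 < p < L /\ k = cf h L b p.-1.
Proof.
rewrite /act_sem /= /back {1}/tape; split.
  move=> [g [di [dw []]]]; case: ltnP => // pL; case: p pL => //= p pL.
  move=> [<- <- <-] ->; split=> //=; congr Cfg.
  exact: upd_same.
case=> /andP[p0 pL] ->; rewrite pL; case: p pL p0 => // p pL _ /=.
exists (tape L b p.+1), DS, DL; split=> //=.
by rewrite upd_same.
Qed.

Lemma at_mark_sem h L b p k :
  asem at_mark (cf h L b p) k <-> [/\ p = 0, 0 < L & k = cf h L b p].
Proof.
rewrite /act_sem /= /at_mark {1}/tape; split.
  move=> [g [di [dw []]]]; case: ltnP => // pL; case: p pL => //= pL.
  move=> [<- <- <-] ->; split=> //=; congr Cfg.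
  exact: upd_same.
case=> -> L0 ->; rewrite L0 /=.
exists (tape L b 0), DS, DS; split=> //=.
by rewrite upd_same.
Qed.

Lemma on_input_sem P d h t p k :
  asem (on_input P d) (Cfg h t p) k <->
  P (read_input x h) /\ k = Cfg (move_in (size x) d h) t p.
Proof.
rewrite /act_sem /= /on_input; split.
  move=> [g [di [dw []]]]; case: ifP => // Pi [<- <- <-] ->; split=> //=.
  by rewrite upd_same.
case=> -> ->; exists (t p), d, DS; split=> //=; by rewrite upd_same.
Qed.

Lemma rewind_sem h L b p k : p < L ->
  sem asem rewind (cf h L b p) k <-> k = cf h L b 0.
Proof.
move=> pL; split=> /=.
  move=> [k1 H].
  have [p' -> ] : exists p', k1 = cf h L b p'.
    apply: (star_inv (P := fun k => exists p', k = cf h L b p')) H; last by exists p.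
    by move=> a c [p' ->] /back_sem [_ ->]; exists p'.-1.
  by move=> /at_mark_sem [-> _ ->].
move=> ->; exists (cf h L b 0); last by apply/at_mark_sem; split=> //; lia.
elim: p pL => [|p IH] pL; first exact: star_refl.
apply: star_step (IH (ltnW pL)); apply/back_sem; split=> //; lia.
Qed.

Lemma tape_eq L b c : (forall i, i < L -> b i = c i) -> tape L b = tape L c.
Proof.
move=> H; apply: functional_extensionality => i; rewrite /tape.
by case: ltnP => // /H ->.
Qed.

(** Each iteration moves the head one cell to the right, so every cell is treated at most once and
    the choices are independent. *)
Lemma star_cells c (Q : bits -> bits -> Prop) h L b p k :
  (forall b p k, sem asem c (cf h L b p) k <->
     exists2 d, p < L /\ Q (b p) d & k = cf h L (upd b p d) p.+1) ->
  p <= L ->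
  star (sem asem c) (cf h L b p) k <->
  exists p' b', [/\ p <= p' <= L, k = cf h L b' p',
    forall i, p <= i < p' -> Q (b i) (b' i) & forall i, ~~ (p <= i < p') -> b' i = b i].
Proof.
move=> Hc pL; split.
  move E: (cf h L b p) => k0 H; elim: H b p pL E => [k1|k0' k1 k2 H01 _ IH] b p pL E.
    exists p, b; split=> //; [lia|by move=> i; lia].
  move: H01; rewrite -E => /Hc [d [{}pL Qd] E1].
  have [p' [b' [H1 H2 H3 H4]]] := IH _ _ pL (esym E1).
  exists p', b'; split=> //; first lia.
    move=> i ip; have [->|ne] := eqVneq i p; first by rewrite H4 ?/upd ?eqxx //; lia.
    by move: (H3 i); rewrite /upd (negbTE ne); apply; lia.
  move=> i ip; rewrite H4; last by lia.
  by rewrite /upd; case: eqP => // ?; lia.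
case=> p' [b' [/andP[pp' p'L] -> H3 H4]].
move Ed: (p' - p) => d; elim: d p b pL pp' Ed H3 H4 => [|d IH] p b pL pp' Ed H3 H4.
  have -> : p' = p by lia.
  have -> : b' = b by apply: functional_extensionality => i; apply: H4; lia.
  exact: star_refl.
apply: (@star_step _ _ _ (cf h L (upd b p (b' p)) p.+1)).
  by apply/Hc; exists (b' p) => //; split; [lia|apply: H3; lia].
apply: IH; [lia..| |].
  by move=> i ip; rewrite /upd ifF; [apply: H3; lia|lia].
move=> i ip; rewrite /upd; case: eqP => [->|ne] //; apply: H4; lia.
Qed.

Lemma star_test P h L b p k : p <= L ->
  star (sem asem (test P)) (cf h L b p) k <->
  exists p', [/\ p <= p' <= L, k = cf h L b p' & forall i, p <= i < p' -> P (b i)].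
Proof.
move=> pL; rewrite (@star_cells _ (fun c d => P c /\ d = c)) //; last first.
  move=> b1 p1 k1; rewrite test_sem; split.
    by move=> [? ? ->]; exists (b1 p1); rewrite ?upd_same.
  by case=> d [? [? ->]] ->; rewrite upd_same.
split.
  move=> [p' [b' [H1 -> H3 H4]]]; have -> : b' = b.
    apply: functional_extensionality => i.
    by case: (boolP (p <= i < p')) => [/H3 []|/H4].
  by exists p'; split=> // i /H3 [].
case=> p' [H1 -> H3]; exists p', b; split=> // i ip; split=> //; exact: H3.
Qed.

Lemma sweep_sem c h L b k : 0 < L ->
  (forall k1, sem asem c (cf h L b 0) k1 -> exists p' b', p' <= L /\ k1 = cf h L b' p') ->
  sem asem (sweep c) (cf h L b 0) k <->
  exists2 b', sem asem c (cf h L b 0) (cf h L b' L) & k = cf h L b' 0.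
Proof.
move=> L0 Hc; split.
  move=> [k1 H1 [k2 H2 H3]].
  have [p' [b' [p'L E]]] := Hc _ H1; rewrite {}E in H1 H2.
  move/at_end_sem: H2 => [Lp E2]; rewrite {}E2 in H3.
  have E : p' = L by lia.
  rewrite {}E in H1 H3; exists b' => //.
  by move: H3 => /rewind_sem ->; last by lia.
case=> b' H1 ->; exists (cf h L b' L) => //; exists (cf h L b' L.-1).
  by apply/at_end_sem.
by apply/rewind_sem => //; lia.
Qed.

Lemma sweep_star_test P h L b k : 0 < L ->
  sem asem (sweep (Star (test P))) (cf h L b 0) k <->
  k = cf h L b 0 /\ forall i, i < L -> P (b i).
Proof.
move=> L0; rewrite sweep_sem //; last first.
  by move=> k1 /star_test [] // p' [? -> _]; exists p', b.
split.
  case=> b' /star_test [] // p' [_ [Eb Ep] H] ->.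
  have Eb2 i : i < L -> b' i = b i.
    by move=> iL; move: (f_equal (fun t => t i) Eb); rewrite /tape iL => -[].
  split; first by congr Cfg; apply: tape_eq.
  by move=> i iL; apply: H; rewrite -Ep.
by case=> -> H; exists b => //; apply/star_test => //; exists L; split=> [|//|i /H]; rewrite ?leqnn.
Qed.

Lemma rbits_inord r v i : v <= K -> rbits r i (inord v) = bit (r v) i.
Proof. by move=> vK; rewrite /rbits ffunE inordK. Qed.

Lemma ctr_sem a s k : mregs K a -> mwf x s ->
  sem asem (ctr a) (rep s) k <-> exists2 s', k = rep s' & mstep x a s s'.
Proof.
case: s => L h r Ka [/= L0 hN rL]; rewrite /rep /=.
have st (P : Prop) : (k = cf h L (rbits r) 0 /\ P) <->
    exists2 s', k = Cfg (mh s') (tape (mL s') (rbits (mr s'))) 0 &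
      s' = MState L h r /\ P.
  split; first by case=> -> p; exists (MState L h r).
  by case=> s' -> [-> p].
case: a Ka => [v|u v|u v|v|||P|] Ka; rewrite /mstep [ctr _]/=.
- pose Q (c d : bits) := d = setb (inord v) true c \/ d = setb (inord v) false c.
  set c := Alt _ _.
  have Hc b p k1 : sem asem c (cf h L b p) k1 <->
     exists2 d, p < L /\ Q (b p) d & k1 = cf h L (upd b p d) p.+1.
    rewrite /= !on_cell_sem; split.
      by case=> [[? _ ->]|[? _ ->]]; eexists; try reflexivity; split=> //; [left|right].
    by case=> d [pL [->|->]] ->; [left|right].
  have SC b k1 := star_cells b k1 Hc (leq0n L).
  rewrite sweep_sem //; last by move=> k1 /SC [p' [b' [? -> _ _]]]; exists p', b'.
  split.
    move=> [b' /SC [p' [b2 [_ [Eb Ep] H3 _]]] ->].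
    have Eb2 i : i < L -> b' i = b2 i.
      by move=> iL; move: (f_equal (fun t => t i) Eb); rewrite /tape iL => -[].
    (* Whatever digits the loop wrote on the track, they are the expansion of some word. *)
    have [w wL Hw] := bit_ex L (fun i => b2 i (inord v)).
    exists (MState L h (upd r v w)); last by exists w.
    congr Cfg; apply: tape_eq => i iL; rewrite Eb2 //.
    have := H3 i; rewrite -Ep => /(_ iL) HQ.
    apply/ffunP => u; rewrite /rbits !ffunE /= /upd.
    case: (nat_of_ord u =P v) => [uv|uv].
      by rewrite Hw //; congr (b2 i _); apply: val_inj; rewrite /= inordK.
    have uv2 : u == inord v = false.
      by apply/eqP => E; apply: uv; rewrite E inordK.
    by case: HQ => ->; rewrite /setb /rbits !ffunE uv2.
  case=> s' -> [w wL ->] /=.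
  exists (rbits (upd r v w)) => //.
  (* [star_cells] also fixes what lies outside the treated block, so the witness keeps the old
     columns from [L] on, where the tape is blank anyway. *)
  apply/SC; exists L, (fun i => if i < L then rbits (upd r v w) i else rbits r i).
  split=> //.
  + by rewrite leqnn.
  + by congr Cfg; apply: tape_eq => i ->.
  + move=> i /andP [_ iL]; rewrite iL.
    have -> : rbits (upd r v w) i = setb (inord v) (bit w i) (rbits r i).
      apply/ffunP => u; rewrite /rbits /setb !ffunE /upd.
      rewrite -(inj_eq val_inj) /= inordK //.
      by case: eqP.
    by case: (bit w i); [left|right].
  + by move=> i /=; case: ltnP.
- case: Ka => uK vK; rewrite sweep_star_test //.
  have -> : (forall i, i < L -> rbits r i (inord u) == rbits r i (inord v)) <-> r u = r v.
    split=> [H|E i iL]; last by rewrite !rbits_inord // E.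
    by apply: bit_inj (rL u) (rL v) _ => i /H; rewrite !rbits_inord // => /eqP.
  exact: st.
- case: Ka => uK vK; rewrite -(st (r v = (r u).+1)) (bit_suc (rL u) (rL v)).
  set c := Seq _ _; have Hc k1 : sem asem c (cf h L (rbits r) 0) k1 <->
      exists p' j, [/\ k1 = cf h L (rbits r) p', j < p' <= L,
        forall i, i < j -> bit (r u) i && ~~ bit (r v) i,
        ~~ bit (r u) j && bit (r v) j & forall i, j < i < p' -> bit (r u) i = bit (r v) i].
    rewrite /c /=; split.
      move=> [k2 /star_test [] // j [_ -> H1] [k3 /test_sem [jL H2 ->]]].
      move=> /star_test [] // p' [H4 -> H3]; exists p', j; split=> //.
      + by move=> i /H1; rewrite !rbits_inord.
      + by move: H2; rewrite !rbits_inord.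
      + by move=> i /H3; rewrite !rbits_inord // => /eqP.
    move=> [p' [j [-> /andP [jp pL] H1 H2 H3]]].
    exists (cf h L (rbits r) j).
      by apply/star_test => //; exists j; split=> [|//|i /H1]; [lia|rewrite !rbits_inord].
    exists (cf h L (rbits r) j.+1).
      by apply/test_sem; split=> //; [lia|rewrite !rbits_inord].
    apply/star_test; first by lia.
    exists p'; split=> [|//|i /H3]; first by lia.
    by rewrite !rbits_inord // => ->.
  rewrite sweep_sem //; last first.
    by move=> k1 /Hc [p' [j [-> ? _ _ _]]]; exists p', (rbits r); split=> //; lia.
  split.
    move=> [b' /Hc [p' [j [[Eb <-] ? H1 H2 H3]] ->]]; split.
      by rewrite Eb.
    by exists j; split=> //; lia.
  move=> [-> [j [H0 H1 H2 H3]]]; exists (rbits r) => //.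
  by apply/Hc; exists L, j; split=> //; rewrite H0 /=.
- rewrite sweep_star_test //.
  have -> : (forall i, i < L -> ~~ rbits r i (inord v)) <-> r v = 0.
    split=> [H|E i iL]; last by rewrite !rbits_inord // E /bit div0n.
    apply: bit_inj (rL v) _ _; first by rewrite expn_gt0.
    by move=> i /H; rewrite !rbits_inord // /bit div0n; case: (odd _).
  exact: st.
- split.
    move=> [k1 /on_input_sem [_ ->] [k2 H2]].
    have [h' -> hN'] : exists2 h', k2 = Cfg h' (tape L (rbits r)) 0 & h' <= size x.
      apply: (star_inv (P := fun k => exists2 h', k = Cfg h' (tape L (rbits r)) 0
          & h' <= size x)) H2.
        by move=> a b [h' -> ?] /on_input_sem [_ ->] /=; exists h'.-1 => //; lia.
      by exists h.-1 => //; lia.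
    move=> /on_input_sem [Hr ->] /=; exists (MState L 0 r) => //=; congr Cfg.
    by move: Hr; rewrite /= /read_input; case: ifP => //; lia.
  case=> s' -> -> /=.
  exists (Cfg h.-1 (tape L (rbits r)) 0); first by apply/on_input_sem.
  exists (Cfg 0 (tape L (rbits r)) 0); last by apply/on_input_sem.
  have : h.-1 <= size x by lia.
  elim: (h.-1) => [|h' IH] h'N; first exact: star_refl.
  apply: star_step (IH (ltnW h'N)); apply/on_input_sem; split=> //.
  by rewrite /read_input /= h'N.
- rewrite [sem _ _]/= on_input_sem /=; split; first by case=> _ ->; eexists; last by reflexivity.
  by case=> s' -> ->.
- rewrite [sem _ _]/= on_input_sem -(st (P (read_input x h))); split; by case.
- split.
    move=> [k1 /star_test [] // p [pL -> H1]] [k2 [g [di [dw []]]]] /=.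
    rewrite /extend {1}/tape; case: ltnP => // Lp [<- <- <-] -> /= H2.
    have Ep : p = L by lia.
    subst p; exists (MState L.+1 h r) => /=; last first.
      split=> //; apply/(bit_ones (rL 0)) => i /H1.
      by rewrite /rbits ffunE.
    move: H2.
    (* The new column of zeros is digit [L] of every value below [2 ^ L], so growing changes no
       register. *)
    have -> : upd (tape L (rbits r)) L (Some (false, [ffun=> false])) = tape L.+1 (rbits r).
      apply: functional_extensionality => i; rewrite /upd /tape.
      case: (i =P L) => [->|ne].
        rewrite ltnSn gtn_eqF //; congr (Some (_, _)).
        by apply/ffunP => u; rewrite /rbits !ffunE (bit_big (L := L)).
      by have -> : (i < L.+1) = (i < L) by lia.
    by move=> /rewind_sem ->.
  case=> s' -> [-> E] /=.
  exists (cf h L (rbits r) L).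
    apply/star_test => //; exists L; split=> [|//|i /andP [_ iL]]; first by rewrite leqnn.
    by rewrite /rbits ffunE /=; apply: (proj2 (bit_ones (rL 0))).
  exists (cf h L.+1 (rbits r) L); last by apply/rewind_sem.
  exists (Some (false, [ffun=> false])), DS, DS; rewrite /extend /= /tape ltnn; split=> //.
  congr Cfg => /=; apply: functional_extensionality => i; rewrite /upd.
  case: (i =P L) => [->|ne].
    rewrite ltnSn gtn_eqF //; congr (Some (_, _)).
    by apply/ffunP => u; rewrite /rbits !ffunE (bit_big (L := L)).
  by have -> : (i < L.+1) = (i < L) by lia.
Qed.

End Tape.

(** * Head positions during the implementation of an atom *)

Section TapeSpace.
Variables (K : nat) (x : seq sym).
Notation asem := (@act_sem (cell K) x).
Notation cf h L b p := (Cfg h (@tape K L b) p).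

Definition in_bounds L (k : cfg (cell K)) : Prop :=
  exists h b p, k = cf h L b p /\ p <= L.

Definition bounded L (a : act (cell K)) : Prop :=
  forall k k', in_bounds L k -> asem a k k' -> in_bounds L k'.

Lemma bounded_on_cell L P f : bounded L (on_cell P f).
Proof.
move=> k k' [h [b [p [-> pL]]]] /on_cell_sem [pL' _ ->].
by exists h, (upd b p (f (b p))), p.+1.
Qed.

Lemma bounded_at_end L : bounded L (@at_end K).
Proof.
move=> k k' [h [b [p [-> pL]]]] /at_end_sem [_ ->].
by exists h, b, p.-1; split=> //; lia.
Qed.

Lemma bounded_back L : bounded L (@back K).
Proof.
move=> k k' [h [b [p [-> pL]]]] /back_sem [_ ->].
by exists h, b, p.-1; split=> //; lia.
Qed.

Lemma bounded_at_mark L : bounded L (@at_mark K).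
Proof.
by move=> k k' [h [b [p [-> pL]]]] /at_mark_sem [_ _ ->]; exists h, b, p.
Qed.

Lemma bounded_on_input L P d : bounded L (@on_input K P d).
Proof.
by move=> k k' [h [b [p [-> pL]]]] /on_input_sem [_ ->]; exists (move_in (size x) d h), b, p.
Qed.

Hint Resolve bounded_on_cell bounded_at_end bounded_back bounded_at_mark
  bounded_on_input : core.

Lemma bounded_pre L c k k' : allat (bounded L) c ->
  in_bounds L k -> pre asem c k k' -> in_bounds L k'.
Proof.
move=> Hc Ik; apply: (pre_inv (P := bounded L) _ Hc Ik) => a k1 k2 Ba.
exact: Ba.
Qed.

Lemma in_bounds_rep s : in_bounds (mL s) (rep K s).
Proof. by exists (mh s), (rbits K (mr s)), 0. Qed.

Lemma in_bounds_pos L k : in_bounds L k -> cpos k <= L.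
Proof. by case=> h [b [p [-> pL]]]. Qed.

(** The successor is there for [MGrow], which rewinds over a tape that already has one more cell. *)
Lemma ctr_pre a s k : mregs K a -> mwf x s ->
  pre asem (ctr K a) (rep K s) k -> cpos k <= (mL s).+1.
Proof.
move=> Ka ws; have Ir := in_bounds_rep s.
have main : allat (bounded (mL s)) (ctr K a) ->
    pre asem (ctr K a) (rep K s) k -> cpos k <= (mL s).+1.
  by move=> Ha /(bounded_pre Ha Ir)/in_bounds_pos/leqW.
case: a Ka main => [v|u v|u v|v|||P|] Ka main; try by apply: main => /=; auto.
move=> {main} [|[k1 H1 [|[k2 H2 H3]]]].
- pose c0 := Star (@test K (fun b => b ord0)).
  move=> H; apply/leqW/in_bounds_pos/(@bounded_pre (mL s) c0 _ _ _ Ir H).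
  exact: bounded_on_cell.
- case: s ws Ir H1 => L h r ws _; rewrite /rep /= => /star_test [] // p [/= pL -> _].
  case=> [<-|[g [di [dw []]]]] /=; first exact: leqW.
  by rewrite /extend /tape; case: ifP => // _ [<- <- <-] -> /=; apply: leqW.
- case: s ws Ir H1 H2 => L h r ws _; rewrite /rep /= => /star_test [] // p [/= pL -> _].
  move=> [g [di [dw []]]] /=.
  rewrite /extend {1}/tape; case: ltnP => // Lp [<- <- <-] E2.
  suff Ib : in_bounds L.+1 k2.
    apply/in_bounds_pos/(@bounded_pre L.+1 (rewind K) k2 k _ Ib H3).
    by split; [apply: bounded_back|apply: bounded_at_mark].
  exists h, (upd (rbits K r) L [ffun=> false]), p; split; last exact: leqW.
  have Ep : p = L by lia.
  have L0 : L != 0 by case: ws => /=; lia.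
  rewrite E2 /= Ep; congr Cfg; apply: functional_extensionality => i.
  rewrite /upd /tape; case: (i =P L) => [->|ne]; first by rewrite ltnSn (negbTE L0).
  by have -> : (i < L.+1) = (i < L) by lia.
Qed.

End TapeSpace.

(** The choice between [Eps] and [MGrow] is in effect forced: an all-ones register has no successor
    in the old range, and [MGrow] is blocked in all other cases. Register 1 serves to increment
    register 0. *)
Definition alloc_round : re matom :=
  Seq (At MRight) (Seq (Alt Eps (At MGrow)) (Seq (At (MGuess 1)) (Seq (At (MSuc 0 1))
    (Seq (At (MGuess 0)) (At (MEq 0 1)))))).

(* Register 0 follows the input head to the right end marker; a cell is added
   exactly when the counter is about to overflow. *)
Definition alloc : re matom :=
  Seq alloc_round (Seq (Star (Seq (At (MRead isSome)) alloc_round))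
                       (At (MRead (negb \o isSome)))).

Definition mstart : mstate := MState 1 0 (fun=> 0).

Section Alloc.
Variable x : seq sym.
Notation msem := (mstep x).

(** The exponent is the word length before the last growth: at a growth this power equals the new
    head position, which is at most [(size x).+1]. *)
Definition small (s : mstate) : Prop := 2 ^ (mL s).-1 <= (size x).+1.
Definition counting (s : mstate) : Prop := [/\ mwf x s, mr s 0 = mh s & small s].

Lemma alloc_round_sem s s' : counting s -> mh s <= size x ->
  sem msem alloc_round s s' -> counting s' /\ mh s' = (mh s).+1.
Proof.
case: s => L h r [ws r0 sm] /= hN [s1 E1 [s2 H2 [s3 H3 [s4 H4 [s5 H5 H6]]]]].
rewrite /= in r0.
have Em : minn h.+1 (size x).+1 = h.+1 by lia.
rewrite {}Em in E1.
have [E2 sm2] : mh s2 = h.+1 /\ mr s2 = r /\ small s2.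
  case: H2 => [<-|[-> /= E]]; rewrite E1 //=; split=> //; split=> //.
  by move: E; rewrite E1 /small /= r0 => <-; lia.
have w2 : mwf x s2.
  have w1 := mwf_step (a := MRight) ws (_ : mstep x MRight _ s1).
  rewrite /= (minn_idPl _) in w1; last by lia.
  have {}w1 := w1 E1; case: H2 => [<- //|H]; exact: (mwf_step (a := MGrow) w1 H).
have w3 := mwf_step (a := MGuess 1) w2 H3.
have w4 := mwf_step (a := MSuc 0 1) w3 H4.
have w5 := mwf_step (a := MGuess 0) w4 H5.
have w6 := mwf_step (a := MEq 0 1) w5 H6.
case: sm2 => E2r sm2.
case: H3 => k3 _ E3; case: H4 => E4 H4; case: H5 => k5 _ E5; case: H6 => E6 H6.
subst s' s5 s4 s3; rewrite /= /upd /= in H4 H6 w6 *.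
rewrite E2r r0 in H4.
by split=> //; split=> //=; rewrite E2 H6 H4.
Qed.

Lemma alloc_round_pre s s' : counting s -> mh s <= size x ->
  pre msem alloc_round s s' -> small s'.
Proof.
case: s => L h r [ws r0 sm] /= hN; rewrite /= in r0.
have Em : minn h.+1 (size x).+1 = h.+1 by lia.
rewrite Em.
case=> [[<- //|-> //]|[s1 E1]].
have sm1 : small s1 by rewrite E1.
have gr s2 : mstep x MGrow s1 s2 -> small s2.
  by rewrite E1 /= r0 => -[-> E]; rewrite /small /= -E; lia.
case=> [[<- //|[<- //|/gr //]]|[s2 H2]].
have sm2 : small s2 by case: H2 => [<- //|/gr //].
case=> [[<- //|[k _ -> //]]|[s3 [k _ ->]]].
case=> [[<- //|[-> //]]|[s4 [-> _]]].
case=> [[<- //|[k5 _ -> //]]|[s5 [k5 _ ->]]].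
by case=> [<- //|[-> //]].
Qed.

Lemma alloc_round_ex s : counting s -> mh s <= size x ->
  exists s', sem msem alloc_round s s'.
Proof.
case: s => L h r [[/= L0 _ rL] /= r0 sm] hN.
suff [L' L'L Hg] : exists2 L', h.+1 < 2 ^ L' &
    sem msem (Alt Eps (At MGrow)) (MState L h.+1 r) (MState L' h.+1 r).
  exists (MState L' h.+1 (upd (upd r 1 h.+1) 0 h.+1)).
  exists (MState L h.+1 r); first by rewrite /=; congr MState; lia.
  exists (MState L' h.+1 r) => //.
  exists (MState L' h.+1 (upd r 1 h.+1)); first by exists h.+1.
  exists (MState L' h.+1 (upd r 1 h.+1)); first by split=> //; rewrite /= /upd /= r0.
  exists (MState L' h.+1 (upd (upd r 1 h.+1) 0 h.+1)); first by exists h.+1.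
  by split.
have := rL 0; rewrite r0 leq_eqVlt => /orP [/eqP E|lt]; last by exists L => //; left.
exists L.+1; first by rewrite expnS -E; lia.
by right; rewrite /= r0.
Qed.

Lemma counting_start : counting mstart.
Proof. by split=> //; split. Qed.

Lemma read_isSome h : h <= (size x).+1 -> isSome (read_input x h) = (0 < h <= size x).
Proof. by rewrite /read_input; case: ifP. Qed.

(** Positivity of the head position tells apart the two end markers, which read alike; the round
    before the loop has left the left one. *)
Lemma alloc_loop_sem s s' : counting s -> 0 < mh s ->
  star (sem msem (Seq (At (MRead isSome)) alloc_round)) s s' -> counting s' /\ 0 < mh s'.
Proof.
move=> cs h0; apply: (star_inv (P := fun s => counting s /\ 0 < mh s)); last by [].
move=> a b [ca a0] [c [-> Hr] Hb].
have ha : mh a <= size x by move: Hr; rewrite /read_input a0 /=; case: ifP.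
by have [? ->] := alloc_round_sem ca ha Hb.
Qed.

Lemma alloc_sem s : sem msem alloc mstart s ->
  [/\ mwf x s, small s & (size x).+1 < 2 ^ mL s].
Proof.
move=> [s1 H1 [s2 H2 [-> Hr]]].
have [c1 h1] := alloc_round_sem counting_start (leq0n _) H1.
have [[w2 E2 sm2] h2] := alloc_loop_sem c1 ltac:(by rewrite h1) H2.
split=> //; case: w2 => _ hN /(_ 0); rewrite E2.
move: Hr; rewrite /= read_isSome // h2 /=; lia.
Qed.

Lemma alloc_pre s : pre msem alloc mstart s -> small s.
Proof.
case=> [|[s1 H1]]; first exact: alloc_round_pre counting_start (leq0n _).
have [c1 h1] := alloc_round_sem counting_start (leq0n _) H1.
have h1' : 0 < mh s1 by rewrite h1.
case=> [[s2 /(alloc_loop_sem c1 h1') [c2 h2]]|[s2 /(alloc_loop_sem c1 h1') [c2 h2]]].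
  have sm2 : small s2 by case: c2.
  case=> [[<- //|[-> _] //]|[s3 [-> Hr]]].
  by apply: alloc_round_pre => //; move: Hr; rewrite /read_input h2 /=; case: ifP.
have sm2 : small s2 by case: c2.
by case=> [<- //|[-> //]].
Qed.

Lemma alloc_ex : exists s, sem msem alloc mstart s.
Proof.
have [s1 H1] := alloc_round_ex counting_start (leq0n _).
have [c1 h1] := alloc_round_sem counting_start (leq0n _) H1.
have {}h1 : 0 < mh s1 by rewrite h1.
suff [s2 H2 Hr] : exists2 s2,
    star (sem msem (Seq (At (MRead isSome)) alloc_round)) s1 s2 & size x < mh s2.
  exists s2; exists s1 => //; exists s2 => //; split=> //=.
  by rewrite /read_input; case: ifP => //; lia.
move Ed: ((size x).+1 - mh s1) => d.
elim: d s1 c1 h1 Ed {H1} => [|d IH] s1 c1 h1 Ed.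
  by exists s1; [exact: star_refl|lia].
have hN : mh s1 <= size x by lia.
have [s2 H2] := alloc_round_ex c1 hN.
have [c2 h2] := alloc_round_sem c1 hN H2.
have [||s3 H3 ?] := IH s2 c2; [by rewrite h2|by rewrite h2; lia|].
exists s3 => //; apply: star_step H3; exists s1 => //.
by split=> //; rewrite /read_input h1 hN.
Qed.

End Alloc.

(** * Register programs run in logarithmic space *)

Definition nogrow (a : matom) : Prop := if a is MGrow then False else True.

Section RegisterMachine.
Variables (K : nat) (c : re matom).
Hypotheses (cK : allat (mregs K.+1) c) (cg : allat nogrow c).

(** The bound [K.+1] on register numbers guarantees registers 0 and 1, which the allocation uses. *)
Definition tape_program : re (act (cell K.+1)) :=
  Seq (At (@start K.+1)) (bind (ctr K.+1) (Seq alloc c)).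

Definition register_machine : NTM := machine None tape_program.

Lemma start_sem x k : act_sem x (@start K.+1) (init_cfg None) k <-> k = rep K.+1 mstart.
Proof.
have E : upd (fun=> None) 0 (Some (true, [ffun=> false])) = tape 1 (rbits K.+1 (fun=> 0)).
  by apply: functional_extensionality => -[|i]; rewrite /upd /tape.
rewrite /act_sem /start /rep -E; split.
  by move=> [g [di [dw [[<- <- <-] ->]]]].
by move=> ->; exists (Some (true, [ffun=> false])), DS, DS.
Qed.

Lemma all_regs : allat (mregs K.+1) (Seq alloc c).
Proof. by []. Qed.

Lemma mwf_start x : mwf x mstart.
Proof. by case: (counting_start x). Qed.

Lemma register_machine_accepts x : accepts register_machine x <->
  exists2 s, sem (mstep x) alloc mstart s & exists s', sem (mstep x) c s s'.
Proof.
have wst (a : matom) s s' : mregs K.+1 a -> mwf x s -> mstep x a s s' -> mwf x s'.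
  by move=> _; apply: mwf_step.
have Hb k := bind_sem wst (@ctr_sem K.+1 x) k all_regs (mwf_start x).
rewrite machine_accepts /tape_program; split.
  move=> [k [k1 /start_sem -> /Hb [s' _ [s H1 H2]]]].
  by exists s => //; exists s'.
move=> [s H1 [s' H2]]; exists (rep K.+1 s'), (rep K.+1 mstart); first exact/start_sem.
by apply/Hb; exists s' => //; exists s.
Qed.

Lemma register_machine_logspace : logspace register_machine.
Proof.
(* With [l] the truncated logarithm of the input length, [small] allows words of [l + 2] digits, the
   head goes at most one further, and positions start at 0: at most [l + 4] cells. *)
exists 4 => x k Rk.
have wst (a : matom) s s' : mregs K.+1 a -> mwf x s -> mstep x a s s' -> mwf x s'.
  by move=> _; apply: mwf_step.
suff /machine_space H : forall k, pre (act_sem x) tape_program (init_cfg None) k ->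
    cpos k <= trunc_log 2 (size x) + 3.
  by apply: leq_trans (H _ Rk) _; lia.
move=> {Rk}k [[<- //|/start_sem -> //]|[k1 /start_sem ->]].
have good_rep s : mwf x s -> cpos (rep K.+1 s) <= (mL s).+1 by [].
move=> /(bind_pre wst (@ctr_sem K.+1 x) good_rep (@ctr_pre K.+1 x) all_regs (mwf_start x)).
move=> [s Hs Hk]; apply: leq_trans Hk _.
suff: small x s.
  rewrite /small => H.
  have /(leq_trans H) : (size x).+1 <= 2 ^ (trunc_log 2 (size x)).+1.
    exact: trunc_log_ltn.
  by rewrite leq_exp2l //; lia.
(* After the allocation nothing grows the tape, so its bound persists through [c]. *)
case: Hs => [/alloc_pre //|[s1 /alloc_sem [_ sm _]]].
apply: (pre_inv (P := nogrow) (I := small x)) => //.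
move=> a t t' + st; case: a => [v|u v|u v|v|||P|] //= _.
- by move=> [? _ ->].
- by move=> [-> _].
- by move=> [-> _].
- by move=> [-> _].
- by move=> ->.
- by move=> ->.
- by move=> [-> _].
Qed.

End RegisterMachine.

(** * A positive logic with transitive closure *)

(* Variables are de Bruijn indices.  [FLoop k a f b] says that some path of
   [k]-vectors with all steps in [f] leads from [a] to [b]; the body [f] sees the
   new vector first, then the old one, then the context. *)
Inductive fm :=
  | FEq of nat & nat
  | FSuc of nat & nat
  | FZero of nat
  | FSym of (option sym -> bool) & nat
  | FAnd of fm & fm
  | FOr of fm & fm
  | FEx of fm
  | FLoop of nat & fm & fm & fm.

Definition vec (B k : nat) (u : seq nat) : Prop := size u = k /\ all (fun i => i < B) u.

Fixpoint eval (B : nat) (x : seq sym) (p : fm) (l : seq nat) : Prop :=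
  match p with
  | FEq a b => nth 0 l a = nth 0 l b
  | FSuc a b => nth 0 l b = (nth 0 l a).+1
  | FZero a => nth 0 l a = 0
  | FSym P a => P (read_input x (nth 0 l a))
  | FAnd p q => eval B x p l /\ eval B x q l
  | FOr p q => eval B x p l \/ eval B x q l
  | FEx p => exists2 i, i < B & eval B x p (i :: l)
  | FLoop k a f b => exists u v, [/\ vec B k u, eval B x a (u ++ l),
      star (fun u u' => vec B k u' /\ eval B x f (u' ++ u ++ l)) u v &
      eval B x b (v ++ l)]
  end.

Fixpoint guess (d k : nat) : re matom :=
  if k is k'.+1 then Seq (guess d k') (At (MGuess (d + k'))) else Eps.

Fixpoint copy (d k m : nat) : re matom :=
  if m is m'.+1 then
    Seq (copy d k m') (Seq (At (MGuess (d + m'))) (At (MEq (d + m') (d + k + m'))))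
  else Eps.

Definition tick (d : nat) : re matom :=
  Seq (At (MGuess d.+1)) (Seq (At (MSuc d d.+1)) (Seq (At (MGuess d))
    (Seq (At (MEq d d.+1)) (At MRight)))).

(* At depth [d] the variables live in registers [0 .. d-1], the outermost in
   register 0. *)
Fixpoint compile (d : nat) (p : fm) : re matom :=
  match p with
  | FEq a b => At (MEq (d - a.+1) (d - b.+1))
  | FSuc a b => At (MSuc (d - a.+1) (d - b.+1))
  | FZero a => At (MZero (d - a.+1))
  | FSym P a => Seq (At MHome) (Seq (At (MGuess d)) (Seq (At (MZero d))
      (Seq (Star (tick d)) (Seq (At (MEq d (d - a.+1))) (At (MRead P))))))
  | FAnd p q => Seq (compile d p) (compile d q)
  | FOr p q => Alt (compile d p) (compile d q)
  | FEx p => Seq (At (MGuess d)) (compile d.+1 p)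
  | FLoop k a f b => Seq (guess d k) (Seq (compile (d + k) a)
      (Seq (Star (Seq (guess (d + k) k) (Seq (compile (d + k + k) f) (copy d k k))))
           (compile (d + k) b)))
  end.

(** The conditions on [K] reserve scratch registers: [d] and [d.+1] for the counter of [FSym], and
    two vectors for [FLoop]. *)
Fixpoint scoped (K d : nat) (p : fm) : bool :=
  match p with
  | FEq a b | FSuc a b => (a < d) && (b < d)
  | FZero a => a < d
  | FSym _ a => (a < d) && (d < K)
  | FAnd p q | FOr p q => scoped K d p && scoped K d q
  | FEx p => (d <= K) && scoped K d.+1 p
  | FLoop k a f b => [&& d + k + k <= K.+1, scoped K (d + k) a,
      scoped K (d + k + k) f & scoped K (d + k) b]
  end.

Lemma allat_guess P d k : (forall i, i < k -> P (MGuess (d + i))) -> allat P (guess d k).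
Proof. by elim: k => //= k IH H; split; [apply: IH => i ik|]; apply: H; lia. Qed.

Lemma allat_copy P d k m :
  (forall i, i < m -> P (MGuess (d + i)) /\ P (MEq (d + i) (d + k + i))) ->
  allat P (copy d k m).
Proof.
by elim: m => //= m IH H; split; [apply: IH => i im|]; apply: H; lia.
Qed.

Lemma compile_nogrow d p : allat nogrow (compile d p).
Proof.
elim: p d => //= k a IHa f IHf b IHb d; split; first exact: allat_guess.
split=> //; split=> //; split; first exact: allat_guess.
by split=> //; apply: allat_copy.
Qed.

Lemma compile_regs K d p : scoped K d p -> d <= K.+1 -> allat (mregs K) (compile d p).
Proof.
elim: p d => /= [a b|a b|a|P a|p IHp q IHq|p IHp q IHq|p IHp|k a IHa f IHf b IHb] d.
- by move=> /andP [? ?] ?; lia.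
- by move=> /andP [? ?] ?; lia.
- by move=> ?; lia.
- by move=> /andP [? ?] ?; do !split=> //; lia.
- by move=> /andP [? ?] ?; split; [apply: IHp|apply: IHq].
- by move=> /andP [? ?] ?; split; [apply: IHp|apply: IHq].
- by move=> /andP [? ?] ?; split => //; apply: IHp.
- move=> /and4P [H Ha Hf Hb] ?; split; first by apply: allat_guess => i ik /=; lia.
  split; first by apply: IHa => //; lia.
  split; last by apply: IHb => //; lia.
  split; first by apply: allat_guess => i ik /=; lia.
  split; first by apply: IHf => //; lia.
  by apply: allat_copy => i ik /=; lia.
Qed.

(** Listed from the highest register down, since the innermost variable, of index 0, occupies the
    highest register. *)
Fixpoint seg (r : nat -> nat) (d k : nat) : seq nat :=
  if k is k'.+1 then r (d + k') :: seg r d k' else [::].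

Notation env d r := (seg r 0 d).

Lemma size_seg r d k : size (seg r d k) = k.
Proof. by elim: k => //= k ->. Qed.

Lemma env_cat r d k : env (d + k) r = seg r d k ++ env d r.
Proof. by elim: k => [|k IH]; rewrite ?addn0 // addnS /= IH add0n. Qed.

Lemma nth_env r d a : a < d -> nth 0 (env d r) a = r (d - a.+1).
Proof.
elim: d a => // d IH [_|a ad] /=; first by rewrite add0n subSS subn0.
by rewrite IH // subSS.
Qed.

Lemma eq_seg r r' d k : (forall i, d <= i < d + k -> r i = r' i) -> seg r d k = seg r' d k.
Proof.
elim: k => //= k IH H; rewrite H ?IH //; last by lia.
by move=> i ik; apply: H; lia.
Qed.

(** * Correctness of the evaluation of formulas by register programs *)

Section Comp.
Variables (L K : nat) (x : seq sym).
Notation msem := (mstep x).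
Notation ev := (eval (2 ^ L) x).
Notation vec := (vec (2 ^ L)).

Definition good (s : mstate) : Prop := mwf x s /\ mL s = L.

Definition agree d (s s' : mstate) : Prop :=
  good s' /\ forall i, i < d -> mr s' i = mr s i.

Lemma agree_env d s s' : agree d s s' -> env d (mr s') = env d (mr s).
Proof. by move=> [_ H]; apply: eq_seg => i /andP [_]; apply: H. Qed.

Lemma agreeW d d' s s' : d' <= d -> agree d s s' -> agree d' s s'.
Proof. by move=> dd [g H]; split=> // i id; apply: H; lia. Qed.

Lemma agree_trans d s1 s2 s3 : agree d s1 s2 -> agree d s2 s3 -> agree d s1 s3.
Proof. by move=> [_ H] [g H']; split=> // i id; rewrite H' // H. Qed.

Lemma agree_refl d s : good s -> agree d s s.
Proof. by []. Qed.

Lemma vec_seg s d k : good s -> vec k (seg (mr s) d k).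
Proof.
move=> [[_ _ H] E]; split; first exact: size_seg.
by elim: k => //= k ->; rewrite -E H.
Qed.

Lemma good_guess s v k : good s -> k < 2 ^ L ->
  good (MState (mL s) (mh s) (upd (mr s) v k)).
Proof.
move=> [w E] kL; split=> //; apply: (mwf_step (a := MGuess v) w); exists k => //.
by rewrite E.
Qed.

Lemma guess_sound d k s s' : good s -> sem msem (guess d k) s s' -> agree d s s'.
Proof.
move=> gs; elim: k s' => [|k IH] s' /=; first by move=> <-; apply: agree_refl.
move=> [s1 /IH A1 [i iL ->]]; apply: (agree_trans A1); case: A1 => g1 _.
split; first by apply: good_guess => //; case: g1 => _ <-.
by move=> j jd; rewrite /= /upd ifF //; lia.
Qed.

Lemma guess_complete d k s u : good s -> vec k u ->
  exists2 s', sem msem (guess d k) s s' & seg (mr s') d k = u.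
Proof.
move=> gs; elim: k u => [|k IH] [|i u] [] //= => [_ _|[su] /andP [iB uB]].
  by exists s.
have [|s1 H1 E1] := IH u; first by [].
have [g1 _] := guess_sound gs H1.
exists (MState (mL s1) (mh s1) (upd (mr s1) (d + k) i)).
  by exists s1 => //; exists i => //; case: g1 => _ ->.
rewrite /= {1}/upd eqxx -E1; congr cons.
by apply: eq_seg => j jk; rewrite /upd ifF //; lia.
Qed.

Lemma copy_sound d k m s s' : good s -> m <= k -> sem msem (copy d k m) s s' ->
  [/\ agree d s s', seg (mr s') d m = seg (mr s) (d + k) m &
      forall i, d + m <= i -> mr s' i = mr s i].
Proof.
move=> gs; elim: m s' => [|m IH] s' mk /=; first by move=> <-; split.
move=> [s1 /IH [|A1 E1 H1]]; first by lia.
move=> [s2 [i iL E2] [-> E3]].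
move: E3; rewrite E2 /= /upd eqxx ifF; last by lia.
move=> Ei; split.
- apply: (agree_trans A1); split; last by move=> j jd; rewrite /= ifF //; lia.
  by case: A1 => g1 _; apply: good_guess; rewrite -?(proj2 g1).
- rewrite {1}Ei H1; last by lia.
  rewrite -E1; congr cons; apply: eq_seg => j jm; rewrite ifF //; lia.
- by move=> j jm; rewrite ifF; [apply: H1; lia|lia].
Qed.

Lemma copy_complete d k m s : good s -> m <= k -> exists s', sem msem (copy d k m) s s'.
Proof.
move=> gs; elim: m => [|m IH] mk /=; first by exists s.
have [|s1 H1] := IH; first by lia.
have [[g1 _] _ _] := copy_sound gs (ltnW mk) H1.
pose i := mr s1 (d + k + m).
exists (MState (mL s1) (mh s1) (upd (mr s1) (d + m) i)), s1 => //.
exists (MState (mL s1) (mh s1) (upd (mr s1) (d + m) i)).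
  by exists i => //; case: g1 => -[_ _ H] _; apply: H.
by split=> //; rewrite /= /upd eqxx ifF //; lia.
Qed.

Definition tracking d (s : mstate) : Prop := mh s = minn (mr s d) (size x).+1.

Lemma tick_sound d s s' : good s -> tracking d s -> sem msem (tick d) s s' ->
  [/\ agree d s s', tracking d s' & mr s' d = (mr s d).+1].
Proof.
move=> [w EL] tr [s1 [i iL E1] [s2 [E2 H2] [s3 [j jL E3] [s4 [E4 H4] E5]]]].
rewrite /= in E5; subst s2 s4 s1 s3 s'; rewrite /= /upd !eqxx ?ifF in H2 H4 jL; try lia.
rewrite /tracking /agree /good /= /upd eqxx.
have -> : j = (mr s d).+1 by rewrite H4 H2.
split=> //; last by rewrite tr; lia.
split; last by move=> l ld; rewrite !ifF //; lia.
split=> //; case: w => ? ? H; split=> //=; first by rewrite geq_minr.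
by move=> v; rewrite -H2 /upd; case: ifP => // _; case: ifP.
Qed.

Lemma tick_complete d s : good s -> (mr s d).+1 < 2 ^ L -> exists s', sem msem (tick d) s s'.
Proof.
move=> [w EL]; set i := (mr s d).+1 => iL.
pose s1 := MState (mL s) (mh s) (upd (mr s) d.+1 i).
pose s2 := MState (mL s) (mh s) (upd (mr s1) d i).
exists (MState (mL s) (minn (mh s).+1 (size x).+1) (mr s2)).
exists s1; first by exists i => //; rewrite EL.
exists s1; first by split=> //; rewrite /= /upd eqxx ifF //; lia.
exists s2; first by exists i => //=; rewrite EL.
exists s2 => //; split=> //; rewrite /= /upd !eqxx ifF //; lia.
Qed.

(** Values beyond the input leave the head on the right marker; both read as [None], so saturation
    is invisible. *)
Lemma read_minn i : read_input x (minn i (size x).+1) = read_input x i.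
Proof.
rewrite /read_input; case: (leqP i (size x).+1) => H; first by [].
by rewrite !ifF //; lia.
Qed.

(** Preserving the registers below [d] is what lets conjuncts and loop bodies run one after the
    other in the same environment. Higher registers and the input head end up arbitrary, which is
    why [FSym] brings the head home first. *)
Lemma compile_correct p d s : scoped K d p -> good s ->
  (forall s', sem msem (compile d p) s s' -> agree d s s' /\ ev p (env d (mr s))) /\
  (ev p (env d (mr s)) -> exists s', sem msem (compile d p) s s').
Proof.
elim: p d s => [a b|a b|a|P a|p IHp q IHq|p IHp q IHq|p IHp|k a IHa f IHf b IHb] d s /=.
- move=> /andP [ad bd] gs; rewrite !nth_env //.
  by split=> [s' [-> ->]|E] //; exists s.
- move=> /andP [ad bd] gs; rewrite !nth_env //.
  by split=> [s' [-> ->]|E] //; exists s.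
- move=> ad gs; rewrite !nth_env //.
  by split=> [s' [-> ->]|E] //; exists s.
- move=> /andP [ad dK] gs; rewrite nth_env //.
  pose s0 := MState (mL s) 0 (upd (mr s) d 0).
  have B0 : 0 < 2 ^ L by rewrite expn_gt0.
  have g0 : good s0.
    have [w E] := good_guess d gs B0; split=> //.
    exact: (mwf_step (a := MHome) w).
  have a0 : agree d s s0 by split=> // i id; rewrite /= /upd ifF //; lia.
  (* [tick] raises register [d] and moves the head together, so the head stands where the register
     says, up to saturation. *)
  pose I t := agree d s t /\ tracking d t.
  have I0 : I s0 by split=> //; rewrite /tracking /= /upd eqxx min0n.
  split.
    move=> s' [s1 E1 [s2 [i iL E2] [s3 [E3 Ei] [s4 H4 [s5 [E5 E6] [-> HP]]]]]].
    subst s1 s3; have E : s2 = s0.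
      by move: Ei; rewrite E2 /= /upd eqxx => ->.
    rewrite {}E in H4.
    have [A4 T4] : I s4.
      apply: star_inv H4 => // t t' [At Tt] Ht.
      have [gt _] := At; have [At' Tt' _] := tick_sound gt Tt Ht.
      by split=> //; apply: agree_trans At At'.
    rewrite E5; split=> //; move: HP; rewrite E5 T4 read_minn E6.
    by case: A4 => _ -> //; lia.
  move=> HP.
  have [s4 H4 [[A4 T4] E4]] : exists2 s4, star (sem msem (tick d)) s0 s4 &
      I s4 /\ mr s4 d = mr s (d - a.+1).
    have : mr s (d - a.+1) < 2 ^ L by case: gs => -[_ _ H] <-.
    elim: (mr s (d - a.+1)) => [|t IH] tL.
      by exists s0; [exact: star_refl|rewrite /= /upd eqxx].
    have [s1 H1 [[A1 T1] E1]] := IH (ltnW tL).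
    have [g1 _] := A1; have [|s2 H2] := tick_complete (d := d) g1; first by rewrite E1.
    have [A2 T2 E2] := tick_sound g1 T1 H2.
    exists s2; first exact: star_rstep H1 H2.
    by rewrite E2 E1; split=> //; split=> //; apply: agree_trans A1 A2.
  exists s4, (MState (mL s) 0 (mr s)) => //.
  exists s0; first by exists 0 => //=; rewrite ?expn_gt0.
  exists s0; first by split=> //; rewrite /= /upd eqxx.
  exists s4 => //; exists s4.
    by split=> //; rewrite E4; case: A4 => _ ->; lia.
  by split=> //; rewrite T4 read_minn E4.
- move=> /andP [sp sq] gs; have [Sp Cp] := IHp d s sp gs; split.
    move=> s' [s1 /Sp [A1 e1]]; have [g1 _] := A1.
    have [Sq _] := IHq d s1 sq g1; move=> /Sq [A2].
    by rewrite (agree_env A1) => e2; split=> //; apply: agree_trans A1 A2.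
  case=> /Cp [s1 H1] e2; have [A1 _] := Sp _ H1; have [g1 _] := A1.
  have [_ Cq] := IHq d s1 sq g1; rewrite (agree_env A1) in Cq.
  by have [s2 H2] := Cq e2; exists s2, s1.
- move=> /andP [sp sq] gs; have [Sp Cp] := IHp d s sp gs.
  have [Sq Cq] := IHq d s sq gs; split.
    by move=> s' [/Sp [A e]|/Sq [A e]]; auto.
  by case=> [/Cp|/Cq] [s' H]; exists s'; auto.
- move=> /andP [dK sp] gs.
  have Ea i : i < 2 ^ L -> agree d s (MState (mL s) (mh s) (upd (mr s) d i)).
    move=> iL; split; first exact: good_guess.
    by move=> j jd; rewrite /= /upd ifF //; lia.
  have Ee i : env d (upd (mr s) d i) = env d (mr s).
    by apply: eq_seg => j jd; rewrite /upd ifF //; lia.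
  split.
    move=> s' [s1 [i iL0 ->] H].
    have iL : i < 2 ^ L by rewrite -(proj2 gs).
    have [g1 _] := Ea i iL.
    have [Sp _] := IHp _ _ sp g1; have [A e] := Sp _ H.
    rewrite /= add0n Ee /upd eqxx in e; split; last by exists i.
    exact: agree_trans (Ea i iL) (agreeW (leqnSn d) A).
  case=> i iL e; have [g1 _] := Ea i iL.
  have [_ Cp] := IHp _ _ sp g1.
  rewrite /= add0n Ee {1}/upd eqxx in Cp; have [s' H] := Cp e.
  exists s', (MState (mL s) (mh s) (upd (mr s) d i)) => //.
  by exists i => //; rewrite (proj2 gs).
- move=> /and4P [dK sa sf sb] gs.
  pose l := env d (mr s).
  pose step u u' := vec k u' /\ ev f (u' ++ u ++ l).
  have El t : agree d s t -> env (d + k) (mr t) = seg (mr t) d k ++ l.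
    by move=> A; rewrite env_cat (agree_env A).
  have dk : d <= d + k by lia.
  pose body := Seq (guess (d + k) k) (Seq (compile (d + k + k) f) (copy d k k)).
  have body_sound t t' : agree d s t -> sem msem body t t' ->
      agree d s t' /\ step (seg (mr t) d k) (seg (mr t') d k).
    move=> At [t1 Ht1 [t2 Ht2 Ht3]].
    have [gt _] := At; have A1 := guess_sound gt Ht1; have [g1 _] := A1.
    have [Sf _] := IHf _ t1 sf g1; have [A2 e2] := Sf _ Ht2; have [g2 _] := A2.
    have [A3 E3 _] := copy_sound g2 (leqnn k) Ht3.
    have As1 := agree_trans At (agreeW dk A1).
    split.
      apply: agree_trans As1 _; apply: agree_trans A3.
      by apply: agreeW A2; lia.
    have E13 : seg (mr t') d k = seg (mr t1) (d + k) k.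
      rewrite E3; apply: eq_seg => i ik; case: A2 => _ -> //; lia.
    rewrite E13; split; first exact: vec_seg.
    move: e2; rewrite env_cat (El _ As1) -/l; congr (ev f (_ ++ _ ++ _)).
    by apply: eq_seg => i ik; case: A1 => _ -> //; lia.
  have body_complete t u' : agree d s t -> step (seg (mr t) d k) u' ->
      exists2 t', sem msem body t t' & seg (mr t') d k = u'.
    move=> At [vu e]; have [gt _] := At.
    have [t1 Ht1 E1] := guess_complete (d + k) gt vu.
    have A1 := guess_sound gt Ht1; have [g1 _] := A1.
    have As1 := agree_trans At (agreeW dk A1).
    have [Sf Cf] := IHf _ t1 sf g1.
    have Ek : seg (mr t1) d k = seg (mr t) d k.
      by apply: eq_seg => i ik; case: A1 => _ -> //; lia.
    rewrite env_cat (El _ As1) E1 Ek in Cf; have [t2 Ht2] := Cf e.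
    have [A2 _] := Sf _ Ht2; have [g2 _] := A2.
    have [t3 Ht3] := copy_complete d g2 (leqnn k).
    have [_ E3 _] := copy_sound g2 (leqnn k) Ht3.
    exists t3; first by exists t1 => //; exists t2.
    rewrite E3 -E1; apply: eq_seg => i ik; case: A2 => _ -> //; lia.
  split.
    move=> s' [s1 H1 [s2 H2 [s3 H3 H4]]].
    have A1 := guess_sound gs H1; have [g1 _] := A1.
    have [Sa _] := IHa _ s1 sa g1; have [A2 e2] := Sa _ H2.
    have As2 := agree_trans A1 (agreeW dk A2).
    rewrite (El _ A1) in e2.
    have E2 : seg (mr s2) d k = seg (mr s1) d k.
      by apply: eq_seg => i ik; case: A2 => _ -> //; lia.
    have [A3 S3] : agree d s s3 /\ star step (seg (mr s1) d k) (seg (mr s3) d k).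
      apply: (star_inv (P := fun t => agree d s t /\
         star step (seg (mr s1) d k) (seg (mr t) d k))) H3.
        move=> t t' [At St] /(body_sound _ _ At) [At' St']; split=> //.
        exact: star_rstep St St'.
      by split=> //; rewrite E2; apply: star_refl.
    have [g3 _] := A3; have [Sb _] := IHb _ s3 sb g3.
    have [A4 e4] := Sb _ H4; rewrite (El _ A3) in e4.
    split; first exact: agree_trans A3 (agreeW dk A4).
    exists (seg (mr s1) d k), (seg (mr s3) d k); split=> //; exact: vec_seg.
  move=> [u [v [vu ea St eb]]].
  have [s1 H1 E1] := guess_complete d gs vu.
  have A1 := guess_sound gs H1; have [g1 _] := A1.
  have [Sa Ca] := IHa _ s1 sa g1; rewrite (El _ A1) E1 in Ca.
  have [s2 H2] := Ca ea; have [A2 _] := Sa _ H2.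
  have As2 := agree_trans A1 (agreeW dk A2).
  have E2 : seg (mr s2) d k = u.
    by rewrite -E1; apply: eq_seg => i ik; case: A2 => _ -> //; lia.
  have [s3 H3 [A3 E3]] : exists2 s3, star (sem msem body) s2 s3 &
      agree d s s3 /\ seg (mr s3) d k = v.
    elim: St s2 As2 E2 {H2 A2} => [w|w w' w'' st _ IH] t At Et.
      by exists t => //; apply: star_refl.
    rewrite -Et in st; have [t' Ht Et'] := body_complete _ _ At st.
    have [At' _] := body_sound _ _ At Ht.
    by have [t'' Ht'' R] := IH _ At' Et'; exists t'' => //; apply: star_step Ht Ht''.
  have [g3 _] := A3; have [_ Cb] := IHb _ s3 sb g3.
  rewrite (El _ A3) E3 in Cb; have [s4 H4] := Cb eb.
  by exists s4, s1 => //; exists s2 => //; exists s3.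
Qed.

End Comp.

(* Uniformity in [B] spares us from knowing the allocated word length. *)
Theorem definable_logspace K (p : fm) : scoped K.+1 0 p ->
  exists M : NTM, logspace M /\ forall x (P : Prop),
    (forall B, (size x).+1 < B -> (eval B x p [::] <-> P)) -> (accepts M x <-> P).
Proof.
move=> sp; exists (register_machine K (compile 0 p)); split.
  by apply: register_machine_logspace; [apply: compile_regs|apply: compile_nogrow].
move=> x P HP; rewrite register_machine_accepts; last exact: compile_regs.
split.
  move=> [s /alloc_sem [ws _ B] [s' Hs]].
  have [S _] := @compile_correct (mL s) K.+1 x p 0 s sp (conj ws erefl).
  by have [_ /HP] := S _ Hs; apply.
move=> p'; have [s Hs] := alloc_ex x; have [ws _ B] := alloc_sem Hs.
exists s => //; have [_ C] := @compile_correct (mL s) K.+1 x p 0 s sp (conj ws erefl).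
by apply: C; apply/HP.
Qed.

(** * Bounded arithmetic in the logic *)

Arguments eval : simpl never.

(** A for loop over vectors (counter, accumulator). [A] and [C] see the context shifted by 2; [T]
    sees new counter, new accumulator, old counter, old accumulator, so its context is shifted by 4.
    This explains the offsets in all later formulas. *)
Definition FFor (m : nat) (A T C : fm) : fm :=
  FLoop 2 (FAnd (FZero 0) A) (FAnd (FSuc 2 0) T) (FAnd (FEq 0 m.+2) C).
(** Every round has to succeed, so a loop is a bounded universal quantifier. The accumulator is
    pinned to 0, and the quantified variable is the old counter, of index 2. *)
Definition FAll (m : nat) (p : fm) : fm :=
  FFor m (FZero 1) (FAnd (FAnd (FZero 1) (FZero 3)) p) (FZero 1).
Definition FAdd (a b c : nat) : fm :=
  FFor b (FEq 1 a.+2) (FSuc 3 1) (FEq 1 c.+2).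
Definition FMul (a b c : nat) : fm :=
  FFor a (FZero 1) (FAdd 3 b.+4 1) (FEq 1 c.+2).
Definition FLt (a b : nat) : fm := FEx (FEx (FAnd (FSuc 1 0) (FAdd a.+2 0 b.+2))).
Definition FNe (a b : nat) : fm := FOr (FLt a b) (FLt b a).

Section Arithmetic.
Variables (B : nat) (x : seq sym).
Hypothesis B0 : 0 < B.
Notation ev := (eval B x).

Definition bd (l : seq nat) : bool := all (fun i => i < B) l.

Lemma bd_nth l a : bd l -> nth 0 l a < B.
Proof.
move=> /allP H; case: (ltnP a (size l)) => al; first exact/H/mem_nth.
by rewrite nth_default.
Qed.

(** Many formulas are characterized only for actual vertices; the first conjunct often provides this
    for the second. *)
Lemma evAnd p q l (P Q : Prop) : (ev p l <-> P) -> (P -> (ev q l <-> Q)) ->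
  (ev (FAnd p q) l <-> P /\ Q).
Proof.
move=> HP HQ; split=> [[/HP p1 q1]|[p1 q1]]; split=> //; first by apply/HQ.
  by apply/HP.
by apply/(HQ p1).
Qed.

Lemma evOr p q l (P Q : Prop) : (ev p l <-> P) -> (ev q l <-> Q) ->
  (ev (FOr p q) l <-> P \/ Q).
Proof. by move=> HP HQ; rewrite -HP -HQ. Qed.

Lemma evEx p l (P : nat -> Prop) : (forall i, i < B -> (ev p (i :: l) <-> P i)) ->
  (ev (FEx p) l <-> exists2 i, i < B & P i).
Proof. by move=> H; split=> -[i iB /(H i iB) Hi]; exists i. Qed.

Fixpoint chain (T : nat -> nat -> nat -> Prop) (k t t' : nat) : Prop :=
  if k is k'.+1 then exists2 t1, t1 < B & chain T k' t t1 /\ T k' t1 t' else t = t'.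

Lemma FForP m A T C l PA PT PC : bd l ->
  (forall t, t < B -> (ev A [:: 0, t & l] <-> PA t)) ->
  (forall i t t', i.+1 < B -> i < nth 0 l m -> t < B -> t' < B ->
     (ev T [:: i.+1, t', i, t & l] <-> PT i t t')) ->
  (forall t, t < B -> (ev C [:: nth 0 l m, t & l] <-> PC t)) ->
  ev (FFor m A T C) l <-> exists t t', [/\ t < B, t' < B, PA t,
    chain PT (nth 0 l m) t t' & PC t'].
Proof.
move=> bl HA HT HC; have mB := bd_nth m bl; set M := nth 0 l m in HT HC mB *.
split.
  case=> u [v [[]]]; case: u => [|i [|t []]] // _ /= /and3P [iB tB _] [/= i0 Ha] S [/= vM Hc].
  subst i.
  (* The loop may overrun [M] before it is left; the guard restricts the claim to rounds for which
     [HT] is available. *)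
  pose I v := exists i1 t1, [/\ v = [:: i1; t1], t1 < B & i1 <= M -> chain PT i1 t t1].
  have : I v.
    apply: star_inv S; last by exists 0, t; split.
    move=> a b [i1 [t1 [-> t1B IH]]] [[]].
    case: b => [|i2 [|t2 []]] // _ /= /and3P [i2B t2B _] [/= Ei HTe].
    exists i2, t2; split=> //; rewrite Ei => i1M; rewrite Ei in i2B HTe.
    exists t1 => //; split; first by apply: IH; lia.
    by apply/(HT i1 t1 t2).
  case=> i1 [t1 [Ev t1B IH]]; rewrite Ev /= in vM Hc; rewrite vM in IH Hc.
  exists t, t1; split=> //; [exact/HA|exact/IH|exact/HC].
case=> t [t' [tB t'B Pt Ch Pt']].
exists [:: 0; t], [:: M; t']; split.
- by split=> //=; rewrite B0 tB.
- by split=> //; apply/HA.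
- move: (leqnn M) t' t'B Ch {Pt'}; move: {1 3 4}M => k.
  elim: k => [|k IH] kM t' t'B /=; first by move=> <-; apply: star_refl.
  move=> [t1 t1B [Ch1 H1]]; apply: star_rstep (IH (ltnW kM) _ t1B Ch1) _.
  split; first by split=> //=; rewrite t'B; lia.
  by split=> //; apply/HT => //; lia.
- by split=> //; apply/HC.
Qed.

Lemma FAllP m p l P : bd l ->
  (forall i, i.+1 < B -> i < nth 0 l m -> (ev p [:: i.+1, 0, i, 0 & l] <-> P i)) ->
  ev (FAll m p) l <-> forall i, i < nth 0 l m -> P i.
Proof.
move=> bl HP.
have -> := FForP (PA := fun t => t = 0) (PT := fun i t t' => (t' = 0 /\ t = 0) /\ P i)
  (PC := fun t => t = 0) bl; try by [].
- have Ch k t t' : t = 0 -> chain (fun i t t' => (t' = 0 /\ t = 0) /\ P i) k t t' ->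
      forall i, i < k -> P i.
    move=> t0; elim: k t' => // k IH t' /= [t1 _ [/IH H [_ Pk]]] i.
    by rewrite ltnS leq_eqVlt => /orP [/eqP ->|/H].
  split; first by move=> [t [t' [_ _ t0 /(Ch _ _ _ t0)]]].
  move=> H; exists 0, 0; split=> //; elim: (nth 0 l m) H => //= k IH H.
  by exists 0 => //; split; [apply: IH => i ik; apply: H; lia|split=> //; apply: H].
- move=> i t t' iB im tB t'B; apply: evAnd => //= -[-> ->]; exact: HP.
Qed.

Lemma FAddP a b c l : bd l ->
  ev (FAdd a b c) l <-> nth 0 l a + nth 0 l b = nth 0 l c.
Proof.
move=> bl.
have -> := FForP (PA := fun t => t = nth 0 l a) (PT := fun i t t' => t' = t.+1)
  (PC := fun t => t = nth 0 l c) bl; try by [].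
have Ch k t t' : t' < B -> chain (fun i t t' => t' = t.+1) k t t' <-> t + k = t'.
  elim: k t' => [|k IH] t' t'B /=; first by rewrite addn0.
  split; first by move=> [t1 t1B [/IH <- // ->]]; rewrite addnS.
  by move=> E; exists (t + k); [lia|split; [apply/IH|]; lia].
split; first by move=> [t [t' [tB t'B -> /Ch <- // ->]]].
move=> E; exists (nth 0 l a), (nth 0 l c); split=> //; try exact: bd_nth.
by apply/Ch => //; apply: bd_nth.
Qed.

Lemma FMulP a b c l : bd l ->
  ev (FMul a b c) l <-> nth 0 l a * nth 0 l b = nth 0 l c.
Proof.
move=> bl; set m := nth 0 l b.
have -> := FForP (PA := fun t => t = 0) (PT := fun i t t' => t + m = t')
  (PC := fun t => t = nth 0 l c) bl; try by [].
- have Ch k t t' : t' < B -> chain (fun i t t' => t + m = t') k t t' <-> t + k * m = t'.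
    elim: k t' => [|k IH] t' t'B /=; first by rewrite mul0n addn0.
    split; first by move=> [t1 t1B [/IH <- // <-]]; rewrite mulSn; lia.
    by rewrite mulSn => E; exists (t + k * m); [lia|split; [apply/IH|]; lia].
  split; first by move=> [t [t' [tB t'B -> /Ch <- // <-]]].
  move=> E; exists 0, (nth 0 l c); split=> //; try exact: bd_nth.
  by apply/Ch => //; apply: bd_nth.
- move=> i t t' iB im tB t'B; apply: FAddP.
  by rewrite /bd /= iB t'B tB (ltnW iB).
Qed.

Lemma FLtP a b l : bd l -> ev (FLt a b) l <-> nth 0 l a < nth 0 l b.
Proof.
move=> bl; rewrite (evEx (P := fun z => exists2 z', z' < B &
  z' = z.+1 /\ nth 0 l a + z' = nth 0 l b)); last first.
  move=> z zB; apply: evEx => z' z'B; apply: evAnd => // _.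
  by apply: FAddP; rewrite /bd /= zB z'B.
split; first by move=> [z _ [z' _ [-> <-]]]; lia.
move=> ab; have bB := bd_nth b bl.
exists (nth 0 l b - (nth 0 l a).+1); first by lia.
exists (nth 0 l b - nth 0 l a); lia.
Qed.

Lemma FNeP a b l : bd l -> ev (FNe a b) l <-> nth 0 l a <> nth 0 l b.
Proof.
by move=> bl; rewrite (evOr (FLtP a b bl) (FLtP b a bl)); lia.
Qed.

End Arithmetic.

Ltac bd_tac := rewrite /bd /=; repeat (apply/andP; split); solve [assumption | lia].

(** * Cardinality of sets of numbers below a bound *)

Fixpoint cnt (P : pred nat) (k : nat) : nat := if k is k'.+1 then cnt P k' + P k' else 0.

Lemma cnt_le (P : pred nat) k : cnt P k <= k.
Proof. by elim: k => //= k IH; case: (P k); lia. Qed.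

Lemma cnt_sub (P Q : pred nat) k : (forall i, i < k -> P i -> Q i) -> cnt P k <= cnt Q k.
Proof.
elim: k => //= k IH H.
have H1 : cnt P k <= cnt Q k by apply: IH => i ik; apply: H; lia.
have := H k (leqnn _); case: (P k) => [/(_ isT) ->|_]; lia.
Qed.

Lemma cnt_eq (P Q : pred nat) k : (forall i, i < k -> P i = Q i) -> cnt P k = cnt Q k.
Proof. by move=> H; apply/eqP; rewrite eqn_leq !cnt_sub // => i ik; rewrite H. Qed.

(** A subset as large as the whole set is the whole set: enough witnesses yield a universal
    statement. *)
Lemma cnt_full (P R : pred nat) k : cnt P k <= cnt (fun i => P i && R i) k ->
  forall i, i < k -> P i -> R i.
Proof.
elim: k => //= k IH H i.
have H1 : cnt (fun i => P i && R i) k <= cnt P k by apply: cnt_sub => j _ /andP [].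
have H2 : cnt P k <= cnt (fun i => P i && R i) k.
  by move: H; case: (P k); case: (R k) => /=; lia.
rewrite ltnS leq_eqVlt => /orP [/eqP ->|]; last exact: IH.
by move: H; case: (P k); case: (R k) => //=; lia.
Qed.

Lemma cnt1 s k : s < k -> cnt (eq_op s) k = 1.
Proof.
elim: k => //= k IH; rewrite ltnS leq_eqVlt => /orP [/eqP ->|sk].
  rewrite eqxx (cnt_eq (Q := pred0)); last by move=> i ik /=; lia.
  by rewrite addn1; congr S; elim: k {IH} => //= k ->.
by rewrite IH //; case: eqP => // ?; lia.
Qed.

(** * Inductive counting *)

Definition isbit (c : bool) (s : option sym) : bool :=
  match s with Some S1 => c | Some S0 => ~~ c | _ => false end.

(** The matrix is stored by rows from input position 1, hence the final successor. With [c] false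
    the formula certifies a non-edge positively, by reading a 0. *)
Definition FE (c : bool) (a b nn : nat) : fm :=
  FAnd (FAnd (FLt a nn) (FLt b nn))
   (FEx (FEx (FEx (FAnd (FMul a.+3 nn.+3 2) (FAnd (FAdd 2 b.+3 1)
     (FAnd (FSuc 1 0) (FSym (isbit c) 0))))))).

Definition FWalk (nn r s y : nat) : fm :=
  FFor r (FEq 1 s.+2) (FE true 3 1 nn.+4) (FEq 1 y.+2).

(** A number may be skipped without any certificate, so this bounds the count only from below and
    needs no negation of [p]. *)
Definition FAtLeast (nn c : nat) (p : fm) : fm :=
  FFor nn (FZero 1) (FOr (FEq 1 3) (FAnd (FSuc 3 1) p)) (FEq 1 c.+2).

(* With [c] the number of ends of walks of length [i] from [s], exhibiting [c]
   such ends that are not adjacent to a vertex certifies that it is not the end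
   of a walk of length [i'] = [i] + 1. *)
Definition FNext (nn s i i' c c' : nat) : fm :=
  FFor nn (FZero 1)
    (FOr (FAnd (FWalk nn.+4 i'.+4 s.+4 2) (FSuc 3 1))
         (FAnd (FAtLeast nn.+4 c.+4
                  (FAnd (FWalk nn.+4.+4 i.+4.+4 s.+4.+4 2) (FE false 2 6 nn.+4.+4)))
               (FEq 1 3)))
    (FEq 1 c'.+2).

(** The accumulator starts at 1, the number of ends of walks of length 0, and each round derives the
    next exact count from the previous one. *)
Definition FCnt (nn s r c : nat) : fm :=
  FFor r (FEx (FAnd (FZero 0) (FSuc 0 2))) (FNext nn.+4 s.+4 2 0 3 1) (FEq 1 c.+2).

(** If all ends of walks, by their exact number, are found among the vertices other than [y], then
    [y] is not one of them. *)
Definition FNWalk (nn r s y : nat) : fm :=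
  FEx (FAnd (FCnt nn.+1 s.+1 r.+1 0)
    (FAtLeast nn.+1 0 (FAnd (FWalk nn.+4.+1 r.+4.+1 s.+4.+1 2) (FNe 2 y.+4.+1)))).

(** Testing lengths below the number of vertices suffices to exclude a connection, since walks can
    be shortened. *)
Definition FMin (nn v u : nat) : fm :=
  FAnd (FEx (FWalk nn.+1 0 v.+1 u.+1))
       (FAll u (FAll nn.+4 (FNWalk nn.+4.+4 2 v.+4.+4 6))).

Definition FDist (nn s y d : nat) : fm :=
  FAnd (FWalk nn d s y) (FAll d (FNWalk nn.+4 2 s.+4 y.+4)).

Definition FNxt (nn a r y b : nat) : fm :=
  FAnd (FE true a b nn) (FAnd (FWalk nn r b y)
    (FAll b (FOr (FE false a.+4 2 nn.+4) (FNWalk nn.+4 r.+4 2 y.+4)))).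

(** Up to the guessed branching point both paths agree, so one accumulator follows the two. The
    remaining length is guessed and checked by an addition, in place of a subtraction. *)
Definition FLex (nn s d v w : nat) : fm :=
  FEx (FFor 0 (FEq 1 s.+3)
    (FEx (FEx (FAnd (FAnd (FSuc 1 0) (FAdd 4 0 d.+4.+3))
       (FAnd (FNxt nn.+4.+3 5 1 v.+4.+3 3) (FNxt nn.+4.+3 5 1 w.+4.+3 3)))))
    (FEx (FEx (FEx (FEx (FAnd (FAnd (FSuc 3 2) (FAdd 4 2 d.+4.+3))
       (FAnd (FAnd (FNxt nn.+4.+3 5 3 v.+4.+3 1) (FNxt nn.+4.+3 5 3 w.+4.+3 0))
             (FLt 1 0)))))))).

Definition FPrec (nn v w : nat) : fm :=
  FEx (FEx (FAnd (FAnd (FMin nn.+2 v.+2 1) (FMin nn.+2 w.+2 0))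
    (FOr (FLt 1 0) (FAnd (FEq 1 0)
      (FEx (FEx (FAnd (FAnd (FDist nn.+4 3 v.+4 1) (FDist nn.+4 3 w.+4 0))
        (FOr (FLt 1 0) (FAnd (FEq 1 0) (FLex nn.+4 3 1 v.+4 w.+4)))))))))).

(** * Walks on numbers and the meaning of the graph formulas *)

Section Walks.
Variables (n : nat) (E : nat -> nat -> bool).

Fixpoint wk (r s y : nat) : bool :=
  if r is r'.+1 then has (fun z => wk r' s z && E z y) (iota 0 n) else s == y.

(** The vertex after [a] on the lexicographically least walk of length [r.+1] from [a] to [y]. *)
Definition nxt (a r y b : nat) : Prop :=
  [/\ E a b, wk r b y & forall b', b' < b -> ~~ (E a b' && wk r b' y)].

Definition dist (s y d : nat) : Prop := wk d s y /\ forall i, i < d -> ~~ wk i s y.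

Definition cmin (v u : nat) : Prop :=
  (exists r, wk r v u) /\ forall i, i < u -> forall r, ~~ wk r v i.

(* [j] is the length of the common prefix of the two least paths, after their
   first vertex [s]. *)
Definition lexprec (s d v w : nat) : Prop :=
  exists (j : nat) (f : nat -> nat), [/\ f 0 = s,
    forall i, i < j -> exists2 r, i + r.+1 = d &
      nxt (f i) r v (f i.+1) /\ nxt (f i) r w (f i.+1) &
    exists r b c, [/\ j + r.+1 = d, nxt (f j) r v b, nxt (f j) r w c & b < c]].

Definition prec (v w : nat) : Prop :=
  exists v0 w0, [/\ cmin v v0, cmin w w0 & v0 < w0 \/ v0 = w0 /\
    exists dv dw, [/\ dist v0 v dv, dist v0 w dw & dv < dw \/ dv = dw /\ lexprec v0 dv v w]].

Hypothesis En : forall i j, E i j -> i < n /\ j < n.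

Lemma wkS r s y : wk r.+1 s y <-> exists2 z, wk r s z & E z y.
Proof.
split=> [/hasP [z _ /andP [? ?]]|[z Hz Ezy]]; first by exists z.
apply/hasP; exists z; last by apply/andP; split.
by rewrite mem_iota /= add0n; have [] := En Ezy.
Qed.

Lemma wk_lt r s y : s < n -> wk r s y -> y < n.
Proof. by case: r => [|r] sn; [move=> /= /eqP <-|move=> /wkS [z _ /En []]]. Qed.

(** [wk] extends walks at their end, as counting requires; least paths are taken apart at their
    start. *)
Lemma wk_cons r s y : wk r.+1 s y <-> exists2 z, E s z & wk r z y.
Proof.
elim: r y => [|r IH] y.
  rewrite wkS /=; split; first by move=> [z /eqP ->]; exists y.
  by move=> [z ? /eqP <-]; exists s.
rewrite wkS; split.
  by move=> [z /IH [t ? ?] ?]; exists t => //; apply/wkS; exists z.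
by move=> [z Esz /wkS [t ? ?]]; exists t => //; apply/IH; exists z.
Qed.

Variables (B : nat) (x : seq sym).
Hypothesis nB : n < B.
Hypothesis Erd : forall i j, i < n -> j < n -> (i * n + j).+1 < B /\
  read_input x (i * n + j).+1 = Some (bitsym (E i j)).
Hypothesis wk_short : forall r s y, s < n -> wk r s y -> exists2 r', r' < n & wk r' s y.

Notation ev := (eval B x).
Notation bdl := (bd B).

Let B0 : 0 < B. Proof. by lia. Qed.

Lemma FEP c a b nn l : bdl l -> nth 0 l nn = n ->
  ev (FE c a b nn) l <-> (nth 0 l a < n /\ nth 0 l b < n) /\ E (nth 0 l a) (nth 0 l b) = c.
Proof.
move=> bl Enn; apply: evAnd.
  by apply: evAnd => [|_]; rewrite -Enn; apply: FLtP.
set i := nth 0 l a; set j := nth 0 l b => -[i_n j_n].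
have [pB rd] := Erd i_n j_n.
rewrite (evEx (P := fun t => exists2 u, u < B & exists2 z, z < B &
   i * n = t /\ t + j = u /\ z = u.+1 /\ isbit c (read_input x z))); last first.
  move=> t tB; apply: evEx => u uB; apply: evEx => z zB.
  have bl3 : bdl [:: z, u, t & l] by bd_tac.
  apply: evAnd; first by rewrite FMulP //= Enn.
  by move=> _; apply: evAnd; [apply: FAddP|move=> _; apply: evAnd].
split.
  move=> [t _ [u _ [z _ [<- [<- [-> ]]]]]]; rewrite rd.
  by case: (E i j) c => -[].
move=> Eij; exists (i * n); first by lia.
exists (i * n + j); first by lia.
exists (i * n + j).+1 => //; do !split=> //; rewrite rd Eij.
by case: c {Eij}.
Qed.

Lemma FWalkP nn r s y l : bdl l -> nth 0 l nn = n -> nth 0 l s < n ->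
  ev (FWalk nn r s y) l <-> wk (nth 0 l r) (nth 0 l s) (nth 0 l y).
Proof.
move=> bl Enn sn.
have -> := FForP B0 (PA := fun t => t = nth 0 l s)
  (PT := fun i t t' => (t < n /\ t' < n) /\ E t t' = true)
  (PC := fun t => t = nth 0 l y) bl; try by [].
- have Ch k t t' : t < n ->
      chain B (fun i t t' => (t < n /\ t' < n) /\ E t t' = true) k t t' <-> wk k t t'.
    elim: k t' => [|k IH] t' tn /=; first by split=> [->|/eqP].
    rewrite -/(wk k.+1 t t') wkS; split.
      by move=> [t1 _ [/IH H1 [_ Et]]]; exists t1 => //; apply: H1.
    move=> [t1 H1 Et]; have [t1n t'n] := En Et.
    by exists t1; [lia|split=> //; apply/IH].
  split; first by move=> [t [t' [_ _ -> /(Ch _ _ _ sn) + <-]]].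
  move=> H; exists (nth 0 l s), (nth 0 l y); split=> //; try exact: bd_nth.
  exact/Ch.
- move=> i t t' iB im tB t'B; apply: FEP => //.
  by bd_tac.
Qed.

Lemma FAtLeastP nn c p l (P : pred nat) : bdl l -> nth 0 l nn = n ->
  (forall y t t', y < n -> t < B -> t' < B ->
    (ev p [:: y.+1, t', y, t & l] <-> P y)) ->
  ev (FAtLeast nn c p) l <-> nth 0 l c <= cnt P n.
Proof.
move=> bl Enn HP.
have -> := FForP B0 (PA := fun t => t = 0)
  (PT := fun i t t' => t' = t \/ t' = t.+1 /\ P i)
  (PC := fun t => t = nth 0 l c) bl; try by [].
- rewrite Enn.
  have Ch k t' : t' < B ->
      chain B (fun i t t' => t' = t \/ t' = t.+1 /\ P i) k 0 t' <-> t' <= cnt P k.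
    elim: k t' => [|k IH] t' t'B /=; first by split=> [<-|]; [|case: t' t'B].
    split.
      move=> [t1 t1B [/(IH _ t1B) H1 [->|[-> ->]]]]; lia.
    case: (boolP (P k)) => Pk /= H.
      case: (leqP t' (cnt P k)) => H1.
        by exists t' => //; split; [apply/IH|left].
      by exists t'.-1; [lia|split; [apply/IH; lia|right; split=> //; lia]].
    by exists t' => //; split; [apply/IH => //; lia|left].
  split; first by move=> [t [t' [_ t'B -> /(Ch _ _ t'B) + <-]]].
  move=> H; exists 0, (nth 0 l c); split=> //; try exact: bd_nth.
  by apply/Ch => //; apply: bd_nth.
- move=> i t t' iB im tB t'B; apply: evOr => //; apply: evAnd => // _.
  by apply: HP => //; rewrite -Enn.
Qed.

(** The certificate of absence is sound because [c] is exact: for a smaller [c], ends adjacent to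
    the vertex could be left out of the enumeration. *)
Lemma FNextP nn s i i' c c' l : bdl l -> nth 0 l nn = n -> nth 0 l s < n ->
  nth 0 l i' = (nth 0 l i).+1 -> nth 0 l c = cnt (wk (nth 0 l i) (nth 0 l s)) n ->
  ev (FNext nn s i i' c c') l <-> nth 0 l c' = cnt (wk (nth 0 l i') (nth 0 l s)) n.
Proof.
move=> bl Enn sn Ei' Ec.
pose W := wk (nth 0 l i') (nth 0 l s).
have -> := FForP B0 (PA := fun t => t = 0)
  (PT := fun i t t' => t' = t + W i)
  (PC := fun t => t = nth 0 l c') bl; try by [].
- rewrite Enn.
  have Ch k t' : t' < B -> chain B (fun i t t' => t' = t + W i) k 0 t' <-> t' = cnt W k.
    elim: k t' => [|k IH] t' t'B /=; first by split=> ->.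
    split; first by move=> [t1 t1B [/(IH _ t1B) -> ->]].
    move=> E1; exists (cnt W k); first by lia.
    by split=> //; apply/IH => //; lia.
  split; first by move=> [t [t' [_ t'B -> /(Ch _ _ t'B) + <-]]].
  move=> H; exists 0, (nth 0 l c'); split=> //; try exact: bd_nth.
  by apply/Ch => //; apply: bd_nth.
- move=> y t t' yB yn tB t'B; rewrite Enn in yn.
  have bl4 : bdl [:: y.+1, t', y, t & l].
    by bd_tac.
  rewrite (evOr (P := W y /\ t' = t.+1) (Q := ~~ W y /\ t' = t)).
  + by case: (W y); rewrite ?addn1 ?addn0; split=> [[[]|[]]|->] //; [left|right].
  + by apply: evAnd => // ; apply: FWalkP.
  apply: evAnd => //.
  rewrite (FAtLeastP _ (P := fun z => wk (nth 0 l i) (nth 0 l s) z && ~~ E z y)) //=; last first.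
    move=> z k k' zn kB k'B.
    have bl8 : bdl [:: z.+1, k', z, k, y.+1, t', y, t & l].
      by bd_tac.
    rewrite (evAnd (P := wk (nth 0 l i) (nth 0 l s) z) (Q := ~~ E z y)).
    * by split=> [[-> ->]|/andP].
    * by apply: FWalkP.
    move=> _; rewrite FEP //=; split; first by case=> _ ->.
    by move=> /negbTE.
  rewrite Ec; split.
    move=> /cnt_full H; apply/negP; rewrite /W Ei' => /wkS [z Hz Ezy].
    by have [zn _] := En Ezy; have := H z zn Hz; rewrite Ezy.
  move=> nW; rewrite (cnt_eq (Q := fun z => wk (nth 0 l i) (nth 0 l s) z && ~~ E z y)) //.
  move=> z zn; case Hz: (wk _ _ z) => //=; apply/esym/negP => Ezy.
  by move/negP: nW; apply; rewrite /W Ei'; apply/wkS; exists z.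
Qed.

Lemma FCntP nn s r c l : bdl l -> nth 0 l nn = n -> nth 0 l s < n ->
  ev (FCnt nn s r c) l <-> nth 0 l c = cnt (wk (nth 0 l r) (nth 0 l s)) n.
Proof.
move=> bl Enn sn.
pose W k := cnt (wk k (nth 0 l s)) n.
have WB k : W k < B by have := cnt_le (wk k (nth 0 l s)) n; rewrite /W; lia.
(* [FNextP] applies only to an exact previous count. The step relation therefore remains an
   uninterpreted evaluation here and is read in [Ch], where induction supplies the exactness. *)
have := FForP B0 (PA := fun t => t = 1)
  (PT := fun i t t' => ev (FNext nn.+4 s.+4 2 0 3 1) [:: i.+1, t', i, t & l])
  (PC := fun t => t = nth 0 l c) bl.
rewrite -/(FCnt nn s r c) => -> //; last first.
  move=> t tB; rewrite (evEx (P := fun z => z = 0 /\ t = z.+1)); last first.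
    by move=> z zB; apply: evAnd.
  by split=> [[z _ [-> ->]]|->] //; exists 0.
have Ch k t' : k < B -> t' < B -> chain B (fun i t t' =>
    ev (FNext nn.+4 s.+4 2 0 3 1) [:: i.+1, t', i, t & l]) k 1 t' <-> t' = W k.
  elim: k t' => [|k IH] t' kB t'B /=.
    by rewrite /W (cnt_eq (Q := eq_op (nth 0 l s))) // cnt1 //; split=> ->.
  have Nx : ev (FNext nn.+4 s.+4 2 0 3 1) [:: k.+1, t', k, W k & l] <-> t' = W k.+1.
    by have WkB := WB k; apply: FNextP => //; bd_tac.
  split.
    by move=> [t1 t1B [/(IH _ (ltnW kB) t1B) ->]] /Nx.
  by move=> /Nx H; exists (W k) => //; split=> //; apply/IH => //; lia.
have rB : nth 0 l r < B by apply: bd_nth.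
split; first by move=> [t [t' [_ t'B -> /(Ch _ _ rB t'B) + <-]]].
move=> H; exists 1, (nth 0 l c); split=> //; try exact: bd_nth; first by lia.
by apply/Ch => //; apply: bd_nth.
Qed.

Lemma FNWalkP nn r s y l : bdl l -> nth 0 l nn = n -> nth 0 l s < n -> nth 0 l y < n ->
  ev (FNWalk nn r s y) l <-> ~~ wk (nth 0 l r) (nth 0 l s) (nth 0 l y).
Proof.
move=> bl Enn sn yn; set W := wk (nth 0 l r) (nth 0 l s).
rewrite (evEx (P := fun c => c = cnt W n /\
   c <= cnt (fun z => W z && (z != nth 0 l y)) n)); last first.
  move=> c cB; have bl1 : bdl (c :: l) by bd_tac.
  apply: evAnd; first exact: FCntP.
  move=> _; apply: FAtLeastP => // z t t' zn tB t'B.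
  have bl5 : bdl [:: z.+1, t', z, t, c & l].
    by bd_tac.
  rewrite (evAnd (P := W z) (Q := z <> nth 0 l y)).
  - by split=> [[-> /eqP ->]|/andP [-> /eqP]].
  - by apply: FWalkP.
  by move=> _; apply: FNeP.
split.
  move=> [c _ [-> /cnt_full H]]; apply/negP => Wy.
  by have := H _ yn Wy; rewrite eqxx.
move=> nW; exists (cnt W n); first by have := cnt_le W n; lia.
split=> //; rewrite (cnt_eq (Q := fun z => W z && (z != nth 0 l y))) // => z zn.
by case: eqP => [->|]; rewrite ?andbT // (negbTE nW).
Qed.

Lemma FMinP nn v u l : bdl l -> nth 0 l nn = n -> nth 0 l v < n ->
  ev (FMin nn v u) l <-> cmin (nth 0 l v) (nth 0 l u).
Proof.
move=> bl Enn vn; apply: evAnd.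
  rewrite (evEx (P := fun r => wk r (nth 0 l v) (nth 0 l u))); last first.
    by move=> r rB; apply: FWalkP => //; bd_tac.
  split; first by move=> [r _ Hr]; exists r.
  by move=> [r /(wk_short vn) [r' r'n Hr]]; exists r' => //; lia.
move=> [r0 /(wk_lt vn) un].
rewrite (FAllP B0 (P := fun i => forall r, ~~ wk r (nth 0 l v) i)) // => i iB iu.
rewrite (FAllP B0 (P := fun r => ~~ wk r (nth 0 l v) i)) /=.
- rewrite Enn; split=> H r; last by move=> _; apply: H.
  apply/negP => /(wk_short vn) [r' /H /negP]; exact.
- by bd_tac.
by move=> r rB rn; apply: FNWalkP => //=; [bd_tac|lia].
Qed.

Lemma FDistP nn s y d l : bdl l -> nth 0 l nn = n -> nth 0 l s < n -> nth 0 l y < n ->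
  ev (FDist nn s y d) l <-> dist (nth 0 l s) (nth 0 l y) (nth 0 l d).
Proof.
move=> bl Enn sn yn; apply: evAnd; first exact: FWalkP.
by move=> _; apply: FAllP => // i iB iD; apply: FNWalkP => //; bd_tac.
Qed.

Lemma FNxtP nn a r y b l : bdl l -> nth 0 l nn = n -> nth 0 l y < n ->
  ev (FNxt nn a r y b) l <-> nxt (nth 0 l a) (nth 0 l r) (nth 0 l y) (nth 0 l b).
Proof.
move=> bl Enn yn; set A := nth 0 l a; set b1 := nth 0 l b; set Y := nth 0 l y.
rewrite (evAnd (P := E A b1) (Q := wk (nth 0 l r) b1 Y /\
   forall b', b' < b1 -> ~~ (E A b' && wk (nth 0 l r) b' Y))).
- by split=> [[? []]|[]].
- by rewrite FEP //; split=> [[_ ->]|H] //; split=> //; apply: En.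
move=> /En [An b1n]; apply: evAnd; first exact: FWalkP.
move=> _; apply: FAllP => // i iB ib.
have bl4 : bdl [:: i.+1, 0, i, 0 & l] by bd_tac.
have i_n : i < n by apply: leq_trans ib (ltnW b1n).
rewrite (evOr (P := ~~ E A i) (Q := ~~ wk (nth 0 l r) i Y)).
- by rewrite negb_and; split=> /orP.
- rewrite FEP //=; split; first by case=> _ ->.
  by move=> /negbTE ->.
exact: FNWalkP.
Qed.

Lemma chain_fun T k t t' : chain B T k t t' ->
  exists f : nat -> nat, [/\ f 0 = t, f k = t' & forall i, i < k -> T i (f i) (f i.+1)].
Proof.
elim: k t' => [|k IH] t' /=; first by move=> ->; exists (fun=> t').
move=> [t1 _ [/IH [f [f0 fk Hf]] Tk]].
exists (fun i => if i <= k then f i else t'); rewrite f0 ltnn; split=> // i ik.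
rewrite (_ : i <= k); last by lia.
by case: (ltnP i k) => H; [apply: Hf|have -> : i = k by lia]; rewrite ?fk.
Qed.

Lemma fun_chain T k (f : nat -> nat) : (forall i, i < k -> f i < B) ->
  (forall i, i < k -> T i (f i) (f i.+1)) -> chain B T k (f 0) (f k).
Proof.
elim: k => [|k IH] fB Hf //=; exists (f k); first exact: fB.
by split; [apply: IH => i ik; [apply: fB|apply: Hf]; lia|apply: Hf].
Qed.

Lemma FLexP nn s d v w l : bdl l -> nth 0 l nn = n -> nth 0 l v < n -> nth 0 l w < n ->
  ev (FLex nn s d v w) l <-> lexprec (nth 0 l s) (nth 0 l d) (nth 0 l v) (nth 0 l w).
Proof.
move=> bl Enn vn wn.
set S := nth 0 l s; set D := nth 0 l d; set V := nth 0 l v; set W := nth 0 l w.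
have DB : D < B by apply: bd_nth.
pose PT i a a' := exists2 r, i + r.+1 = D & nxt a r V a' /\ nxt a r W a'.
pose PC j a := exists r b c, [/\ j + r.+1 = D, nxt a r V b, nxt a r W c & b < c].
rewrite (evEx (P := fun j => exists t t', [/\ t < B, t' < B, t = S,
   chain B PT j t t' & PC j t'])); last first.
  move=> j jB; apply: FForP => //; first by bd_tac.
    move=> i t t' iB im tB t'B.
    rewrite (evEx (P := fun r => exists2 z, z < B & (z = r.+1 /\ i + z = D) /\
   (nxt t r V t' /\ nxt t r W t'))); last first.
      move=> r rB; apply: evEx => z zB.
      have bl7 : bdl [:: z, r, i.+1, t', i, t, j & l] by bd_tac.
      apply: evAnd; first by apply: evAnd => // _; apply: FAddP.
      by move=> _; apply: evAnd => [|_]; apply: FNxtP.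
    split; first by move=> [r _ [z _ [[-> Ez] H]]]; exists r.
    by move=> [r Er H]; exists r; [lia|exists r.+1; [lia|]].
  move=> t tB.
  rewrite (evEx (P := fun r => exists2 z, z < B & exists2 b, b < B & exists2 c, c < B &
    (z = r.+1 /\ j + z = D) /\ ((nxt t r V b /\ nxt t r W c) /\ b < c))); last first.
    move=> r rB; apply: evEx => z zB; apply: evEx => b bB; apply: evEx => c cB.
    have bl7 : bdl [:: c, b, z, r, j, t, j & l] by bd_tac.
    apply: evAnd; first by apply: evAnd => // _; apply: FAddP.
    move=> _; apply: evAnd; last by move=> _; apply: FLtP.
    by apply: evAnd => [|_]; apply: FNxtP.
  split.
    by move=> [r _ [z _ [b _ [c _ [[-> Ez] [[? ?] ?]]]]]]; exists r, b, c.
  move=> [r [b [c [Er Hb Hc bc]]]]; have [Eb _ _] := Hb; have [Ec _ _] := Hc.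
  have [_ b_n] := En Eb; have [_ c_n] := En Ec.
  by exists r; [lia|exists r.+1; [lia|exists b; [lia|exists c; [lia|]]]].
split.
  move=> [j _ [t [t' [_ _ -> /chain_fun [f [f0 fj Hf]] H]]]].
  by exists j, f; split=> //; rewrite fj.
move=> [j [f [f0 Hf H]]].
(* Each of these vertices has an outgoing edge, hence lies below [n]. *)
have fB i : i <= j -> f i < B.
  rewrite leq_eqVlt => /orP [/eqP ->|/Hf [r _ [[/En [fn _] _ _] _]]]; last by lia.
  by case: H => r [b [c [_ [/En [fn _] _ _] _ _]]]; lia.
exists j; first by case: H => r [b [c [? _ _ _]]]; lia.
exists S, (f j); split=> //; first by apply: bd_nth.
  exact: fB.
by rewrite -f0; apply: fun_chain => // i ij; apply: fB; lia.
Qed.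

Lemma FPrecP nn v w l : bdl l -> nth 0 l nn = n -> nth 0 l v < n -> nth 0 l w < n ->
  ev (FPrec nn v w) l <-> prec (nth 0 l v) (nth 0 l w).
Proof.
move=> bl Enn vn wn; set V := nth 0 l v; set W := nth 0 l w.
rewrite (evEx (P := fun v0 => exists2 w0, w0 < B & (cmin V v0 /\ cmin W w0) /\
  (v0 < w0 \/ v0 = w0 /\ exists2 dv, dv < B & exists2 dw, dw < B &
    (dist v0 V dv /\ dist v0 W dw) /\ (dv < dw \/ dv = dw /\ lexprec v0 dv V W)))).
  split.
    move=> [v0 _ [w0 _ [[? ?] H]]]; exists v0, w0; split=> //.
    case: H => [?|[Ev [dv _ [dw _ [[? ?] ?]]]]]; [by left|right; split=> //].
    by exists dv, dw.
  move=> [v0 [w0 [cv cw H]]].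
  have v0n : v0 < n by case: cv => -[r /(wk_lt vn)].
  have w0n : w0 < n by case: cw => -[r /(wk_lt wn)].
  exists v0; first by lia.
  exists w0; first by lia.
  split=> //; case: H => [?|[Ev [dv [dw [Hv Hw Hd]]]]]; [by left|right; split=> //].
  (* A distance is at most the length of any walk, and some walk is shorter than [n]. *)
  have dB y d : dist v0 y d -> d < B.
    move=> [/(wk_short v0n) [r rn Hr] Hd'].
    by case: (leqP d r) => [|/Hd']; [lia|rewrite Hr].
  by exists dv; [exact: dB Hv|exists dw; [exact: dB Hw|]].
move=> v0 v0B; apply: evEx => w0 w0B.
have bl2 : bdl [:: w0, v0 & l] by bd_tac.
apply: evAnd; first by apply: evAnd => [|_]; apply: FMinP.
move=> [[[r /(wk_lt vn) v0n] _] [[r' /(wk_lt wn) w0n] _]].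
apply: evOr; first exact: FLtP.
apply: evAnd => // _; apply: evEx => dv dvB; apply: evEx => dw dwB.
have bl4 : bdl [:: dw, dv, w0, v0 & l] by bd_tac.
apply: evAnd; first by apply: evAnd => [|_]; apply: FDistP.
move=> _; apply: evOr; first exact: FLtP.
apply: evAnd => // _; exact: FLexP.
Qed.

End Walks.

(** * Least paths *)

Section Paths.
Variables (n : nat) (e : rel 'I_n).

(** Edges extended by [false] to all numbers, so that walks can be followed on plain register
    values. *)
Definition adj (i j : nat) : bool :=
  if (insub i, insub j) is (Some a, Some b) then e a b else false.

Lemma adj_ord (a b : 'I_n) : adj a b = e a b.
Proof. by rewrite /adj !valK. Qed.

Lemma adj_lt i j : adj i j -> i < n /\ j < n.
Proof. by rewrite /adj; do 2 case: insubP => // ? ? ?. Qed.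

Lemma adj_ex (a : 'I_n) j : adj a j -> exists2 b : 'I_n, j = b & e a b.
Proof. by move=> H; have [_ jn] := adj_lt H; exists (Ordinal jn); rewrite -?adj_ord. Qed.

Notation W := (wk n adj).
Notation NXT := (nxt n adj).

Lemma wk_path r (a b : 'I_n) :
  W r a b <-> exists p, [/\ size p = r, path e a p & last a p = b].
Proof.
elim: r a => [|r IH] a.
  split; first by move=> /eqP/val_inj ab; exists [::].
  by move=> [[|c p] [//= _ _ ->]].
rewrite (wk_cons adj_lt); split.
  move=> [z /adj_ex [c -> ac] /IH [p [sp pp lp]]].
  by exists (c :: p); rewrite /= sp ac.
move=> [[|c p] [//= [sp] /andP [ac pp] lp]].
by exists (c : nat); rewrite ?adj_ord //; apply/IH; exists p.
Qed.

Lemma wk_connect (a b : 'I_n) : (exists r, W r a b) <-> connect e a b.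
Proof.
split; first by move=> [r /wk_path [p [_ pp <-]]]; apply/connectP; exists p.
by move=> /connectP [p pp ->]; exists (size p); apply/wk_path; exists p.
Qed.

Lemma wk_short r s y : s < n -> W r s y -> exists2 r', r' < n & W r' s y.
Proof.
move=> sn Hr; have yn := wk_lt adj_lt sn Hr.
move: Hr; rewrite -[s]/(val (Ordinal sn)) -[y]/(val (Ordinal yn)).
move=> /wk_path [p [_ pp]]; case/shortenP: pp => p' pp' up' _ lp'.
exists (size p'); last by apply/wk_path; exists p'.
by have := max_card (mem (Ordinal sn :: p')); rewrite (card_uniqP up') card_ord.
Qed.

Lemma cmin_comp_min (v : 'I_n) i : cmin n adj v i <-> i = comp_min e v.
Proof.
rewrite /comp_min; case: arg_minnP => [|u vu umin]; first exact: connect0.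
split.
  move=> [[r Hr] Hi]; have i_n := wk_lt adj_lt (ltn_ord v) Hr.
  have vi : connect e v (Ordinal i_n) by apply/wk_connect; exists r.
  apply/eqP; rewrite eqn_leq (umin _ vi) andbT leqNgt; apply/negP => /Hi H.
  by move/wk_connect: vu => [r' Hr']; move: (H r'); rewrite Hr'.
move=> ->; split; first exact/wk_connect.
move=> j ju r; apply/negP => Hr.
have i_n := ltn_trans ju (ltn_ord u).
have vi : connect e v (Ordinal i_n) by apply/wk_connect; exists r.
by have := umin _ vi; rewrite /= leqNgt ju.
Qed.

Definition lexmin (r : nat) (a y : 'I_n) (p : seq 'I_n) : Prop :=
  [/\ size p = r, path e a p, last a p = y &
    forall q, size q = r -> path e a q -> last a q = y -> ~~ lexlt q p].

(** Among sequences of equal length the lexicographic minimum is greedy: the least first vertex that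
    can be completed, then the least completion. *)
Lemma lexmin_cons r (a b y : 'I_n) p :
  lexmin r.+1 a y (b :: p) <-> NXT a r y b /\ lexmin r b y p.
Proof.
split.
  move=> [/= [sp] /andP [ab pp] lp H]; split; split=> //.
  - by rewrite adj_ord.
  - by apply/wk_path; exists p.
  - move=> b' b'b; apply/negP => /andP [/adj_ex [c Ec ac]]; rewrite Ec in b'b *.
    move=> /wk_path [q [sq pq lq]].
    by have := H (c :: q); rewrite /= sq ac b'b => /(_ erefl pq lq).
  - move=> q sq pq lq; have := H (b :: q).
    by rewrite /= sq ab ltnn eqxx => /(_ erefl pq lq).
move=> [[ab _ Hb] [sp pp lp H]]; split=> //=; first by rewrite sp.
  by rewrite -adj_ord ab.
move=> [|c q] //= [sq] /andP [ac pq] lq; apply/negP => /orP [cb|].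
  have := Hb _ cb; rewrite adj_ord ac /= => /negP; apply.
  by apply/wk_path; exists q.
move=> /andP [/eqP cb qp]; rewrite cb in pq lq.
by have := H q sq pq lq; rewrite qp.
Qed.

Lemma nxt_ex r (a y : 'I_n) : W r.+1 a y -> exists b : 'I_n, NXT a r y b.
Proof.
move=> /(wk_cons adj_lt) [z az zy].
have ex : exists z, adj a z && W r z y by exists z; rewrite az.
case: (ex_minnP ex) => b /andP [ab hby] bmin.
have [c Ec ac] := adj_ex ab; exists c; rewrite -Ec; split=> // b' b'b.
by apply/negP => /bmin; rewrite leqNgt b'b.
Qed.

Lemma nxt_uniq a r y b c : NXT a r y b -> NXT a r y c -> b = c.
Proof.
move=> [ab hb Hb] [ac hc Hc]; case: (ltngtP b c) => // [/Hc|/Hb].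
  by rewrite ab hb.
by rewrite ac hc.
Qed.

Lemma lexmin_ex r (a y : 'I_n) : W r a y -> exists p, lexmin r a y p.
Proof.
elim: r a => [|r IH] a; first by move=> /eqP/val_inj ->; exists [::]; split=> // -[].
move=> /nxt_ex [b Hb]; have [_ /IH [p Hp] _] := Hb.
by exists (b :: p); apply/lexmin_cons.
Qed.

(** Length is compared first, so a least path is a shortest one and only the lexicographic order
    remains among those. *)
Lemma least_path_lexmin (s y : 'I_n) p : least_path e s y p <->
  exists d p', [/\ p = s :: p', dist n adj s y d & lexmin d s y p'].
Proof.
split.
  case: p => [|a p] [] //= /and3P [/eqP -> pp /eqP lp] H.
  exists (size p), p; split=> //; split=> //; first by apply/wk_path; exists p.
    move=> i ip; apply/negP => /wk_path [q [sq pq lq]].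
    by have := H (s :: q); rewrite /= eqxx pq lq eqxx /starlt /= !ltnS sq ip => /(_ isT).
  move=> q sq pq lq; have := H (s :: q).
  by rewrite /= eqxx pq lq eqxx /starlt /= sq !ltnn !eqxx /= => /(_ isT).
move=> [d [p' [-> [_ Hd] [sp pp lp H]]]]; split; first by rewrite /= eqxx pp lp eqxx.
case=> [|a q] //= /and3P [/eqP -> pq /eqP lq].
rewrite /starlt /= ltnS sp eqSS eqxx ltnn /= negb_or negb_and; apply/andP; split.
  by apply/negP => /Hd /negP; apply; apply/wk_path; exists q.
by case: eqP => //= sq; apply: H.
Qed.

(** Splitting off the first step, by shifting [f], brings the prefix description into the recursive
    form of [lexlt]. *)
Lemma lexprecS d v w a : lexprec n adj a d.+1 v w <->
  (exists b c, [/\ NXT a d v b, NXT a d w c & b < c]) \/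
  (exists b, [/\ NXT a d v b, NXT a d w b & lexprec n adj b d v w]).
Proof.
split.
  move=> [[|j] [f [f0 Hf [r [b [c [Er Hb Hc bc]]]]]]].
    have Er' : r = d by lia.
    by subst r; rewrite f0 in Hb Hc; left; exists b, c; split.
  right; have [r0 Er0 [H1 H2]] := Hf 0 isT.
  have Er0' : r0 = d by lia.
  rewrite Er0' f0 in H1 H2; exists (f 1); split=> //.
  exists j, (fun i => f i.+1); split=> // [i ij|].
    by have [r' Er' ?] := Hf i.+1 ij; exists r' => //; lia.
  by exists r, b, c; split=> //; lia.
case=> [[b [c [Hb Hc bc]]]|[b [Hb Hc [j [f [f0 Hf [r [b' [c' [Er Hb' Hc' bc']]]]]]]]]].
  by exists 0, (fun=> a); split=> //; exists d, b, c.
exists j.+1, (fun i => if i is i'.+1 then f i' else a); split=> //.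
  case=> [_|i ij] /=; first by exists d => //; rewrite f0.
  by have [r' Er' ?] := Hf i ij; exists r' => //; lia.
by exists r, b', c'; split=> //; lia.
Qed.

Lemma lexprec_lexlt d (a v w : 'I_n) p q : lexmin d a v p -> lexmin d a w q ->
  lexprec n adj a d v w <-> lexlt p q.
Proof.
elim: d a p q => [|d IH] a p q.
  move=> [/size0nil -> _ _ _] [/size0nil -> _ _ _] /=; split=> //.
  by move=> [j [f [_ _ [r [b [c [? _ _ _]]]]]]]; lia.
case: p => [|b p]; first by case.
case: q => [|c q]; first by move=> _ [].
move=> /lexmin_cons [Hb Hp] /lexmin_cons [Hc Hq]; rewrite lexprecS /=; split.
  case=> [[b' [c' [Hb' Hc' bc]]]|[b' [Hb' Hc' H]]].
    by rewrite (nxt_uniq Hb Hb') (nxt_uniq Hc Hc') bc.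
  have bc : b = c by apply: val_inj; rewrite /= (nxt_uniq Hb Hb') (nxt_uniq Hc Hc').
  rewrite -(nxt_uniq Hb Hb') in H; rewrite -bc in Hq *.
  by rewrite ltnn eqxx /=; apply/(IH _ _ _ Hp Hq).
move=> /orP [bc|/andP [/eqP bc pq]]; first by left; exists b, c.
subst c; right; exists b; split=> //; exact/(IH _ _ _ Hp Hq).
Qed.

Lemma prec_precB (v w : 'I_n) : prec n adj v w <-> precB e v w.
Proof.
rewrite /precB; set v0 := comp_min e v; set w0 := comp_min e w.
have E1 : prec n adj v w <-> (v0 < w0 \/ (v0 : nat) = w0 /\ exists dv dw,
    [/\ dist n adj v0 v dv, dist n adj v0 w dw &
        dv < dw \/ dv = dw /\ lexprec n adj v0 dv v w]).
  split; first by move=> [a [b [/cmin_comp_min -> /cmin_comp_min ->]]].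
  by move=> H; exists v0, w0; split=> //; apply/cmin_comp_min.
rewrite {}E1; case: eqP => /= vw; last first.
  by split=> [[//|[/val_inj]]|]; [|left].
rewrite -vw; split.
  case=> [|[_ [dv [dw [Hv Hw H]]]]]; first by rewrite ltnn.
  have [p Hp] := lexmin_ex (proj1 Hv); have [q Hq] := lexmin_ex (proj1 Hw).
  exists (v0 :: p), (v0 :: q); split.
  - by apply/least_path_lexmin; exists dv, p.
  - by apply/least_path_lexmin; exists dw, q.
  have [sp _ _ _] := Hp; have [sq _ _ _] := Hq.
  rewrite /starlt /= ltnS eqSS sp sq; case: H => [-> //|[Ed H]].
  rewrite -Ed in Hq *.
  by rewrite !ltnn !eqxx /=; apply/(lexprec_lexlt Hp Hq).
move=> [p [q [/least_path_lexmin [dv [p' [-> Hv Hp]]] /least_path_lexmin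
  [dw [q' [-> Hw Hq]]]]]].
have [sp _ _ _] := Hp; have [sq _ _ _] := Hq.
rewrite /starlt /= ltnS eqSS sp sq ltnn eqxx /= => H.
right; split=> //; exists dv, dw; split=> //.
case/orP: H => [|/andP [/eqP Ed H]]; [by left|right; split=> //].
by rewrite -Ed in Hq; apply/(lexprec_lexlt Hp Hq).
Qed.

End Paths.

(** * Decoding the input *)

Definition ishash (s : option sym) : bool := if s is Some SHash then true else false.

(** The first hash directly follows the matrix, so its position determines the number of
    vertices. *)
Definition FIsN (nn p : nat) : fm :=
  FEx (FAnd (FMul nn.+1 nn.+1 0) (FAnd (FSuc 0 p.+1) (FAnd (FSym ishash p.+1)
    (FAll p.+1 (FSym (negb \o ishash) 2))))).

(** The accumulator runs from [m] down to 0, losing its lowest digit in each round; thus no powers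
    of two are needed and all values stay bounded by [m]. *)
Definition FWord (p m q : nat) : fm :=
  FEx (FFor 0 (FEq 1 m.+3)
    (FEx (FEx (FAnd (FAnd (FAdd p.+4.+3 4 1) (FAdd 3 3 0))
      (FOr (FAnd (FSym (isbit true) 1) (FSuc 0 5))
           (FAnd (FSym (isbit false) 1) (FEq 0 5))))))
    (FAnd (FZero 1) (FAdd p.+3 0 q.+3))).

(** From index 7 down to 0 the variables stand for the number of vertices, the first hash, the
    position after it, [v], the second hash, the position after it, [w], and the right end
    marker. *)
Definition FMain : fm :=
  FEx (FEx (FEx (FEx (FEx (FEx (FEx (FEx
    (FAnd (FAnd (FAnd (FIsN 7 6) (FSuc 6 5)) (FAnd (FWord 5 4 3) (FSym ishash 3)))
     (FAnd (FAnd (FSuc 3 2) (FAnd (FWord 2 1 0) (FSym (negb \o isSome) 0)))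
           (FPrec 7 4 1)))))))))).

Section Decode.
Variables (B : nat) (x : seq sym).
Hypothesis xB : (size x).+1 < B.
Notation ev := (eval B x).
Notation bdl := (bd B).
Notation rd := (read_input x).

Let B0 : 0 < B. Proof. by lia. Qed.

Definition word_at (p k m : nat) : Prop :=
  m < 2 ^ k /\ forall i, i < k -> rd (p + i) = Some (bitsym (bit m i)).

Lemma rd_lt i : isSome (rd i) -> 0 < i <= size x.
Proof. by rewrite /read_input; case: ifP. Qed.

Lemma FIsNP nn p l : bdl l -> ev (FIsN nn p) l <->
  [/\ nth 0 l p = (nth 0 l nn * nth 0 l nn).+1, ishash (rd (nth 0 l p)) &
      forall i, i < nth 0 l p -> ~~ ishash (rd i)].
Proof.
move=> bl; rewrite (evEx (P := fun t => nth 0 l nn * nth 0 l nn = t /\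
  (nth 0 l p = t.+1 /\ (ishash (rd (nth 0 l p)) /\
      forall i, i < nth 0 l p -> ~~ ishash (rd i))))); last first.
  move=> t tB; have bl1 : bdl (t :: l) by bd_tac.
  apply: evAnd; first exact: FMulP.
  move=> _; apply: evAnd => // _; apply: evAnd => // _.
  exact: FAllP.
have pB := bd_nth B0 p bl.
split; first by move=> [t _ [<- [-> [? ?]]]].
by move=> [Ep ? ?]; exists (nth 0 l nn * nth 0 l nn) => //; lia.
Qed.

Lemma FWordP p m q l : bdl l -> ev (FWord p m q) l <->
  exists2 k, nth 0 l q = nth 0 l p + k & word_at (nth 0 l p) k (nth 0 l m).
Proof.
move=> bl; set P := nth 0 l p; set M := nth 0 l m; set Q := nth 0 l q.
have MB : M < B by apply: bd_nth.
have QB : Q < B by apply: bd_nth.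
pose PT i t t' := exists2 b : bool, rd (P + i) = Some (bitsym b) & t = b + t'.*2.
rewrite (evEx (P := fun k => exists t t', [/\ t < B, t' < B, t = M,
   chain B PT k t t' & t' = 0 /\ P + k = Q])); last first.
  move=> k kB; have bl1 : bdl (k :: l) by bd_tac.
  apply: FForP => //.
    move=> i t t' iB im tB t'B.
    rewrite (evEx (P := fun z => exists2 u, u < B & (P + i = z /\ t' + t' = u) /\
       (isbit true (rd z) /\ t = u.+1 \/ isbit false (rd z) /\ u = t))); last first.
      move=> z zB; apply: evEx => u uB.
      have bl7 : bdl [:: u, z, i.+1, t', i, t, k & l] by bd_tac.
      apply: evAnd; first by apply: evAnd => [|_]; apply: FAddP.
      by move=> _; apply: evOr; apply: evAnd.
    split.
      move=> [z _ [u _ [[<- <-] H]]]; case E1: (rd (P + i)) H => [[]|] /= [] // [] // _ Et.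
        by exists false => //; lia.
      by exists true => //; lia.
    move=> [b Eb Et]; have := rd_lt (i := P + i); rewrite Eb => /(_ isT) PiB.
    exists (P + i); first by lia.
    exists (t' + t'); first by lia.
    by split=> //; rewrite Eb; case: b Eb Et => _ Et; [left|right]; split=> //=; lia.
  move=> t tB; apply: evAnd => // _; apply: FAddP => //; bd_tac.
have Ch k t' : chain B PT k M t' <-> t' = M %/ 2 ^ k /\
    forall i, i < k -> rd (P + i) = Some (bitsym (bit M i)).
  elim: k t' => [|k IH] t' /=; first by rewrite divn1; split=> [<-|[-> _]].
  have Eh : M %/ 2 ^ k.+1 = (M %/ 2 ^ k)./2 by rewrite expnSr divnMA divn2.
  split.
    move=> [t1 t1B [/IH [E1 H1] [b Eb Et]]].
    have Ebit : bit M k = b by rewrite /bit -E1 Et; case: b {Eb Et}; lia.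
    split; first by rewrite Eh -E1 Et; case: b {Eb Et Ebit}; lia.
    by move=> i; rewrite ltnS leq_eqVlt => /orP [/eqP ->|/H1 //]; rewrite Ebit.
  move=> [Et H]; exists (M %/ 2 ^ k); first by rewrite (leq_ltn_trans (leq_div _ _)).
  split; first by apply/IH; split=> // i ik; apply: H; lia.
  exists (bit M k); first exact: H.
  by rewrite Et Eh /bit odd_double_half.
split.
  move=> [k _ [t [t' [_ _ -> /Ch [Et H] [t0 EQ]]]]]; exists k => //; split=> //.
  by rewrite ltnNge -divn_gt0 ?expn_gt0 // -Et t0.
move=> [k EQ [Mk H]]; exists k; first by lia.
exists M, 0; split=> //; apply/Ch; split=> //; by rewrite divn_small.
Qed.

(** A word stops at the first symbol that is not a bit; this fixes its length, and the digits then
    fix its value. *)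
Lemma word_at_uniq p k m k' m' : word_at p k m -> word_at p k' m' ->
  (forall c, ~~ isbit c (rd (p + k))) -> (forall c, ~~ isbit c (rd (p + k'))) ->
  m = m' /\ k = k'.
Proof.
move=> [mk Hm] [mk' Hm'] nb nb'.
have Ek : k = k'.
  case: (ltngtP k k') => // [/Hm' E|/Hm E].
    by have := nb (bit m' k); rewrite E; case: (bit m' k).
  by have := nb' (bit m k'); rewrite E; case: (bit m k').
subst k'; split=> //; apply: bit_inj mk mk' _ => i ik.
have := Hm i ik; rewrite Hm' // => -[].
by case: (bit m i); case: (bit m' i).
Qed.

End Decode.

(** * Positions in the canonical encoding *)

Lemma bin_aux_bits f m : m <= f -> m < 2 ^ size (bin_aux f m) /\
  forall i, i < size (bin_aux f m) -> nth S0 (bin_aux f m) i = bitsym (bit m i).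
Proof.
elim: f m => [|f IH] m; first by case: m.
have [-> //|m0 mf] := posnP m.
have -> : bin_aux f.+1 m = bitsym (odd m) :: bin_aux f m./2 by case: m m0 mf.
have [|H1 H2] := IH m./2; first by lia.
split; first by rewrite [size _]/= expnS; move: H1; lia.
by case=> [_|i ik]; rewrite /= ?bit0 // bitS; apply: H2.
Qed.

Lemma nth_allpairs_grid (S T R : Type) (f : S -> T -> R) s0 t0 r0 (s : seq S) (t : seq T) i j :
  i < size s -> j < size t ->
  nth r0 [seq f a b | a <- s, b <- t] (i * size t + j) = f (nth s0 s i) (nth t0 t j).
Proof.
elim: s i => // a s IH i iS jT; rewrite allpairs_cons nth_cat size_map.
case: i iS => [|i] iS /=; first by rewrite mul0n add0n jT (nth_map t0).
rewrite ifF; last by rewrite mulSn; lia.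
by rewrite mulSn -addnA addKn IH.
Qed.

Section Encoding.
Variables (n : nat) (e : rel 'I_n) (v w : 'I_n).

Let x := encode e v w.
Let rd := read_input x.

Lemma size_encode : size x = n * n + (size (bin v) + (size (bin w)).+1).+1.
Proof. by rewrite /x /encode size_cat size_allpairs size_enum_ord /= size_cat. Qed.

Lemma rd_nth i : i < size x -> rd i.+1 = Some (nth S0 x i).
Proof. by rewrite /rd /read_input /= => ->. Qed.

Lemma rd_grid i j : i < n -> j < n -> rd (i * n + j).+1 = Some (bitsym (adj e i j)).
Proof.
move=> i_n j_n; have ijn : i * n + j < n * n.
  by have := leq_mul2r n i.+1 n; rewrite i_n orbT mulSn; lia.
rewrite rd_nth; last by rewrite size_encode; lia.
rewrite /x /encode nth_cat size_allpairs size_enum_ord ijn; congr Some.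
have -> : i * n + j = i * size (enum 'I_n) + j by rewrite size_enum_ord.
rewrite (nth_allpairs_grid _ v v) ?size_enum_ord // -adj_ord.
by rewrite !nth_enum_ord.
Qed.

Lemma rd_hash1 : rd (n * n).+1 = Some SHash.
Proof.
rewrite rd_nth; last by rewrite size_encode; lia.
by rewrite /x /encode nth_cat size_allpairs size_enum_ord ltnn subnn.
Qed.

Lemma rd_nohash i : i < (n * n).+1 -> ~~ ishash (rd i).
Proof.
case: i => [|k] kn; first by rewrite /rd /read_input.
have n0 : 0 < n by case: n kn v => //= ? [].
(* Row and column of the matrix entry at this position. *)
have -> : k = (k %/ n) * n + k %% n by apply: divn_eq.
rewrite rd_grid ?ltn_mod // ?ltn_divLR //.
by case: (adj _ _ _).
Qed.

Lemma rd_bin1 : word_at x (n * n).+2 (size (bin v)) v.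
Proof.
have [H1 H2] := bin_aux_bits (leqnn v); split=> // i ik.
rewrite addSn -/rd rd_nth; last by rewrite size_encode; lia.
rewrite -H2 // /x /encode nth_cat size_allpairs size_enum_ord.
rewrite ifF; last by lia.
have -> : (n * n).+1 + i - n * n = i.+1 by lia.
by rewrite /= nth_cat ik.
Qed.

Lemma rd_hash2 : rd ((n * n).+2 + size (bin v)) = Some SHash.
Proof.
rewrite addSn rd_nth; last by rewrite size_encode; lia.
rewrite /x /encode nth_cat size_allpairs size_enum_ord ifF; last by lia.
have -> : (n * n).+1 + size (bin v) - n * n = (size (bin v)).+1 by lia.
by rewrite /= nth_cat ltnn subnn.
Qed.

Lemma rd_bin2 : word_at x ((n * n).+2 + size (bin v)).+1 (size (bin w)) w.
Proof.
have [H1 H2] := bin_aux_bits (leqnn w); split=> // i ik.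
rewrite addSn -/rd rd_nth; last by rewrite size_encode; lia.
rewrite -H2 // /x /encode nth_cat size_allpairs size_enum_ord ifF; last by lia.
have -> : (n * n).+2 + size (bin v) + i - n * n = (size (bin v) + i.+1).+1 by lia.
by rewrite /= nth_cat ifF; [have -> : size (bin v) + i.+1 - size (bin v) = i.+1 by lia|lia].
Qed.

Lemma rd_end : rd (((n * n).+2 + size (bin v)).+1 + size (bin w)) = None.
Proof. by rewrite /rd /read_input size_encode ifF //; lia. Qed.

Lemma FMain_precB B : (size x).+1 < B -> eval B x FMain [::] <-> precB e v w.
Proof.
move=> xB; have B0 : 0 < B by lia.
have sx := size_encode.
have n0 : 0 < n by apply: leq_ltn_trans (ltn_ord v).
have nB : n < B by have := leq_pmulr n n0; lia.
have Erd i j : i < n -> j < n -> (i * n + j).+1 < B /\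
    read_input x (i * n + j).+1 = Some (bitsym (adj e i j)).
  move=> i_n j_n; split; last exact: rd_grid.
  have := rd_lt (x := x) (i := (i * n + j).+1).
  by rewrite -/rd rd_grid // => /(_ isT); lia.
have Hprec := FPrecP (@adj_lt n e) nB Erd (@wk_short n e).
have nbit s c : s = Some SHash \/ s = None -> ~~ isbit c s by case=> ->.
set p := (n * n).+1; set q := p.+1 + size (bin v); set r := q.+1 + size (bin w).
have hp : rd p = Some SHash := rd_hash1.
have hq : rd q = Some SHash := rd_hash2.
have hr : rd r = None := rd_end.
rewrite -prec_precB; split.
  move=> [n' n'B [p' pB [p1 p1B [v' v'B [q' qB [q1 q1B [w' w'B [r' rB]]]]]]]].
  set l := [:: r'; w'; q1; q'; v'; p1; p'; n'].
  have bl : bd B l by rewrite /bd /= n'B pB p1B v'B qB q1B w'B rB.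
  move=> [[[HN /= Ep1] [HW /= hq']] [[/= Eq1 [HW2 /= hr']] Hpr]].
  have /= [Ep hp' nh] := proj1 (FIsNP xB 7 6 bl) HN.
  have /= [k Ek Hk] := proj1 (FWordP xB 5 4 3 bl) HW.
  have /= [k2 Ek2 Hk2] := proj1 (FWordP xB 2 1 0 bl) HW2.
  (* Both are positions of a hash with no hash before it. *)
  have Epn : p' = p.
    case: (ltngtP p' p) => // [/rd_nohash|/nh]; first by rewrite /rd hp'.
    by rewrite -/rd hp.
  have En' : n' = n.
    have /eqP : n' * n' = n * n by move: Ep; rewrite Epn => -[].
    by rewrite !mulnn eqn_sqr => /eqP.
  rewrite Ep1 Epn in Ek Hk.
  have [||Ev Ekv] := word_at_uniq Hk rd_bin1.
  - by move=> c; rewrite -Ek; apply: nbit; left; case: (read_input x q') hq' => [[]|].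
  - by move=> c; rewrite -/rd hq.
  have Eqq : q' = q by rewrite Ek Ekv.
  rewrite Eq1 Eqq in Ek2 Hk2.
  have [||Ew _] := word_at_uniq Hk2 rd_bin2.
  - by move=> c; rewrite -Ek2; apply: nbit; right; case: (read_input x r') hr'.
  - by move=> c; rewrite -/rd hr.
  have := Hprec 7 4 1 l bl; rewrite /= En' Ev Ew => /(_ erefl (ltn_ord v) (ltn_ord w)).
  by case=> + _; apply.
move=> Hpr.
set l := [:: r; w : nat; q.+1; q; v : nat; p.+1; p; n].
have bl : bd B l.
  have := ltn_ord v; have := ltn_ord w; rewrite /bd /= /r /q /p.
  by move=> ? ?; do !(apply/andP; split); lia.
move: (bl); rewrite /bd /= => /and5P [rB wB q1B qB /and5P [vB p1B pB _ _]].
exists n => //; exists p => //; exists p.+1 => //; exists (v : nat) => //.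
exists q => //; exists q.+1 => //; exists (w : nat) => //; exists r => //.
split; [split; [split|split]|split; [split; last split|]] => //.
- apply: (proj2 (FIsNP xB 7 6 bl)); split=> //=; first by rewrite -/rd hp.
  by move=> i /rd_nohash.
- by apply: (proj2 (FWordP xB 5 4 3 bl)); exists (size (bin v)) => //; apply: rd_bin1.
- by rewrite /eval /= -/rd hq.
- by apply: (proj2 (FWordP xB 2 1 0 bl)); exists (size (bin w)) => //; apply: rd_bin2.
- by rewrite /eval /= -/rd hr.
- by apply: (proj2 (Hprec 7 4 1 l bl _ _ _)) => //=.
Qed.

End Encoding.

(** The constant 100 is a generous bound on register numbers; what matters is that it does not
    depend on the input. *)
Lemma FMain_scoped : scoped 100 0 FMain.
Proof. by vm_compute. Qed.

Theorem theorem7 :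
  exists M : NTM, logspace M /\
    forall (n : nat) (e : rel 'I_n), symmetric e -> irreflexive e ->
      forall v w : 'I_n, accepts M (encode e v w) <-> precB e v w.
Proof.
have [M [lM accM]] := definable_logspace FMain_scoped.
exists M; split=> // n e _ _ v w; apply: accM => B; exact: FMain_precB.
Qed.
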